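(* Let $X$ be a nonempty zero-dimensional separable metric space without isolated points which is Borel and countable dense homogeneous (CDH). Then $X$ is homeomorphic to one of the following five spaces: $2^{\omega}$, $\omega^{\omega}$, $2^{\omega}\setminus\{0\}$, $\omega^{\omega}\oplus 2^{\omega}$, $\omega^{\omega}\oplus (2^{\omega}\setminus\{0\})$.
   Context: A separable topological space $X$ is countable dense homogeneous (CDH) if for any two countable dense subsets $D, D' \subseteq X$ there is a homeomorphism $h : X \to X$ such that $h[D]=D'$. A separable metric space is called Borel if it is a Borel subset of its completion. A space is zero-dimensional if it has a base of clopen sets. Here $2^\omega$ is the Cantor space, $\omega^\omega$ is the Baire space, $0$ denotes the constant zero sequence in $2^\omega$, and $\oplus$ denotes disjoint topological sum. *)

(* Defs.v *)
From HB Require Import structures.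
From mathcomp Require Import all_boot all_order all_algebra.
From mathcomp Require Import all_classical all_reals all_analysis.

Set Implicit Arguments.
Unset Strict Implicit.
Unset Printing Implicit Defensive.

Local Open Scope classical_set_scope.
Local Open Scope ring_scope.

Definition separable (T : topologicalType) : Prop :=
  exists2 D : set T, countable D & dense D.

Definition homeomorphism (S T : topologicalType) (h : S -> T) : Prop :=
  continuous h /\
  exists g : T -> S, [/\ cancel h g, cancel g h & continuous g].

Definition homeomorphic (S T : topologicalType) : Prop :=
  exists h : S -> T, homeomorphism h.

Definition CDH (T : topologicalType) : Prop :=
  separable T /\
  forall D D' : set T, countable D -> dense D -> countable D' -> dense D' ->
    exists h : T -> T, homeomorphism h /\ h @` D = D'.

(* The library predicate [zero_dimensional] only asks that distinct points be
   separated by clopen sets, which is weaker for non-compact spaces. *)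
Definition has_clopen_base (T : topologicalType) : Prop :=
  exists2 B : set (set T), B `<=` clopen & basis B.

Definition complete_space (T : uniformType) : Prop :=
  forall F : set_system T, ProperFilter F -> cauchy F -> exists l : T, F --> l.

Definition is_completion (R : realType) (X Y : metricType R) (i : X -> Y) :
    Prop :=
  [/\ complete_space Y,
      forall x y : X, mdist (i x) (i y) = mdist x y
    & dense (range i)].

Definition borel_set (T : topologicalType) : set (set T) := <<s @open T >>.

(* The completion is unique up to a bijective isometry fixing X, so it does not
   matter which one is used. *)
Definition borel_space (R : realType) (X : metricType R) : Prop :=
  exists (Y : metricType R) (i : X -> Y),
    is_completion i /\ borel_set (range i).

Definition baire_space : topologicalType := prod_topology (fun _ : nat => nat).

Definition punctured_cantor_space : topologicalType :=
  set_type (~` [set (fun _ : nat => false) : cantor_space]).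

Definition topological_sum (S T : topologicalType) : topologicalType :=
  {b : bool & if b then S else T}.

(* Main.v *)
Require Import Defs.
From mathcomp Require Import all_boot all_order all_algebra.
From mathcomp Require Import all_classical all_reals all_analysis.
From Stdlib Require Bool Eqdep_dec.

(** The proof has two independent halves.

    1. A Borel CDH space X without isolated points is completely metrizable.
    Let Y be the completion of X. The tool is [ideal_kernel]: X and Y \ X are
    projections of closed subsets F of Y x omega^omega, and F can be shrunk,
    relative to a sigma-ideal of subsets, to a closed set Z all of whose
    nonempty relatively open pieces are large. The Baire category theorem on Z
    then replaces any explicit construction of a perfect tree. CDH is used to
    move one well-chosen countable dense set onto another.
    - The union M of the meager open subsets of X is invariant under
      homeomorphisms and meager. Some countable dense set is a G_delta relative
      to M, so all of them are, and Baire category on Z for the ideal of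
      countable projections makes M countable. A countable dense set containing
      M cannot be carried onto itself minus a point of M, so M is empty
      ([meager_part_eq0]).
    - X has the Baire property in Y and no nonempty open subset of X is meager,
      hence X contains a dense G_delta subset of Y ([dense_Gdelta_in_range]),
      and this G_delta contains a countable dense set. By CDH every countable
      subset of X lies in a G_delta subset of Y contained in X: a homeomorphism
      of X maps G_delta subsets of Y to G_delta subsets of Y
      ([Gdelta_transport]).
    - If X is not a G_delta in Y, take Z over Y \ X for the ideal of sets whose
      projection is covered by an F_sigma missing X. The closures of the
      projections of the pieces of Z all meet X; a countable set E that meets
      all of them lies in a G_delta set inside X, and Baire category on Z gives
      a closed set that misses E but contains one of these closures. This
      contradiction is [range_Gdelta].

    2. A zero-dimensional, completely metrizable, separable CDH space without
    isolated points is one of the five spaces. The set L of points with a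
    compact neighbourhood is open and invariant; its boundary is invariant,
    closed and nowhere dense, and CDH forces such a set to be empty
    ([CDH_invariant_empty]), so L is clopen. The complement of L, if nonempty,
    is a copy of omega^omega, and L, if nonempty, is a copy of the Cantor space
    or, when it is not compact, of the punctured Cantor space. All these
    identifications come from one principle, [scheme_homeomorphic]: a space is
    determined up to homeomorphism by the tree of nonempty nodes of a splitting
    of it into smaller and smaller open sets indexed by finite sequences. *)

Set Implicit Arguments.
Unset Strict Implicit.
Unset Printing Implicit Defensive.

Import Order.TTheory GRing.Theory Num.Theory.

Local Open Scope classical_set_scope.

(** * Splitting schemes *)

(** A splitting of A by open sets indexed by finite sequences, the children of s
    being [rcons s i]. Branches with nonempty nodes shrink to a point, so A is
    the space of branches of the tree t of nonempty nodes. The field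
    [scheme_sep] follows from [scheme_cvg] in a Hausdorff space; having it as a
    field makes schemes transfer along embeddings without any separation
    argument in the new space. *)
Record scheme (X : topologicalType) (A : set X) (t : set (seq nat))
    (P : seq nat -> set X) : Prop := Scheme {
  scheme_root : P [::] = A;
  scheme_open : forall s, open (P s);
  scheme_split : forall s x, P s x <-> exists i, P (rcons s i) x;
  scheme_disj : forall s i j x, P (rcons s i) x -> P (rcons s j) x -> i = j;
  scheme_tree : forall s, t s <-> P s !=set0;
  scheme_complete : forall a : nat -> nat, (forall n, P (mkseq a n) !=set0) ->
    exists x, forall n, P (mkseq a n) x;
  scheme_sep : forall (a : nat -> nat) x y, (forall n, P (mkseq a n) x) ->
    (forall n, P (mkseq a n) y) -> x = y;
  scheme_cvg : forall (a : nat -> nat) x U, (forall n, P (mkseq a n) x) ->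
    nbhs x U -> exists n, P (mkseq a n) `<=` U }.

Definition has_scheme (X : topologicalType) (A : set X) t :=
  exists P, scheme A t P.

Lemma mkseqSl T (f : nat -> T) n :
  mkseq f n.+1 = f 0 :: mkseq (fun k => f k.+1) n.
Proof. by rewrite /mkseq /= -[1]add1n iotaDl -map_comp. Qed.

Lemma scheme_address (X : topologicalType) (A : set X) t P (x : X) :
  scheme A t P -> A x -> exists a, forall n, P (mkseq a n) x.
Proof.
move=> sP Ax.
have /choice[c cP] : forall s, exists i, P s x -> P (rcons s i) x.
  move=> s; have [/(scheme_split sP)[i Pi]|nP] := pselect (P s x).
    by exists i.
  by exists 0 => /nP.
pose s := fix s n := if n is m.+1 then rcons (s m) (c (s m)) else [::].
have Ps n : P (s n) x.
  by elim: n => [|n IH]/=; [rewrite (scheme_root sP)|exact: cP].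
have sE n : mkseq (fun n => c (s n)) n = s n.
  by elim: n => [//|n IH]; rewrite mkseqS IH.
by exists (fun n => c (s n)) => n; rewrite sE.
Qed.

Lemma scheme_address_unique (X : topologicalType) (A : set X) t P (x : X) a s :
  scheme A t P -> (forall n, P (mkseq a n) x) -> P s x -> s = mkseq a (size s).
Proof.
move=> sP aP; elim/last_ind: s => [//|s i IH] Psi.
have Ps : P s x by apply/(scheme_split sP); exists i.
rewrite size_rcons mkseqS -IH//; congr rcons.
apply: (scheme_disj sP Psi).
by rewrite [s in rcons s _]IH// -mkseqS; exact: aP.
Qed.

(** The point of address a is sent to the point of W on the branch a. The
    nodes are sent to nodes with the same index, which is what makes the two
    maps between X and W inverse to each other. *)
Lemma scheme_map (X W : topologicalType) t P Q :
  scheme [set: X] t P -> scheme [set: W] t Q ->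
  exists f : X -> W, continuous f /\ forall s x, P s x -> Q s (f x).
Proof.
move=> sP sQ.
have /choice[f fP] : forall x, exists y, forall s, P s x -> Q s y.
  move=> x; have [a aP] := scheme_address sP (I : setT x).
  have [n|y yP] := scheme_complete sQ (a := a).
    by apply/(scheme_tree sQ)/(scheme_tree sP); exists x.
  exists y => s Ps; rewrite (scheme_address_unique sP aP Ps); exact: yP.
exists f; split=> [x U fxU|s x /fP//].
have [a aP] := scheme_address sP (I : setT x).
have [n nU] := scheme_cvg sQ (fun n => fP _ _ (aP n)) fxU.
have xP : nbhs x (P (mkseq a n)).
  by apply: open_nbhs_nbhs; split; [exact: scheme_open sP _|exact: aP].
by apply: filterS xP => y /fP/nU.
Qed.

Lemma scheme_homeomorphic (X W : topologicalType) t :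
  has_scheme [set: X] t -> has_scheme [set: W] t -> homeomorphic X W.
Proof.
move=> [P sP] [Q sQ].
have [f [cf fP]] := scheme_map sP sQ; have [g [cg gP]] := scheme_map sQ sP.
exists f; split=> //; exists g; split=> // x.
- have [a aP] := scheme_address sP (I : setT x).
  by apply: (scheme_sep sP (a := a)) => // n; apply/gP/fP.
- have [a aP] := scheme_address sQ (I : setT x).
  by apply: (scheme_sep sQ (a := a)) => // n; apply/fP/gP.
Qed.

Lemma has_scheme0 (X : topologicalType) : has_scheme (@set0 X) set0.
Proof.
exists (fun=> set0); split=> //.
- by move=> s; exact: open0.
- by move=> s x; split=> // -[].
- by move=> s; split=> // -[].
- by move=> a /(_ 0)[].
- by move=> a x y /(_ 0).
- by move=> a x y /(_ 0).
Qed.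

(** The tree of a disjoint union of countably many pieces with trees t i: its
    root is nonempty exactly when some piece is. *)
Definition node_tree (t : nat -> set (seq nat)) : set (seq nat) :=
  fun s => if s is i :: s' then t i s' else exists i, t i [::].

Definition node_scheme T (A : set T) (P : nat -> seq nat -> set T) :
  seq nat -> set T := fun s => if s is i :: s' then P i s' else A.

Lemma node_scheme_mkseq T (A : set T) P (a : nat -> nat) n :
  node_scheme A P (mkseq a n.+1) = P (a 0) (mkseq (fun k => a k.+1) n).
Proof. by rewrite mkseqSl. Qed.

Lemma has_scheme_node (X : topologicalType) (A : nat -> set X) t :
  trivIset setT A -> (forall i, has_scheme (A i) (t i)) ->
  has_scheme (\bigcup_i A i) (node_tree t).
Proof.
move=> dA /choice[P sP].
exists (node_scheme (\bigcup_i A i) P).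
have PA i s x : P i s x -> A i x.
  elim/last_ind: s => [|s k IH] Psx; first by rewrite -(scheme_root (sP i)).
  by apply: IH; apply/(scheme_split (sP i)); exists k.
have AP i x : A i x = P i [::] x by rewrite (scheme_root (sP i)).
split=> //.
- case=> [|i s]; last exact: (scheme_open (sP i)).
  by apply: bigcup_open => i _; rewrite -(scheme_root (sP i)); exact: scheme_open.
- case=> [|i s] x /=; last exact: (scheme_split (sP i)).
  by split=> [[i _]|[i]]; rewrite -?AP => Ai; exists i; rewrite -?AP.
- case=> [|k s] i j x /=; last exact: (scheme_disj (sP k)).
  rewrite -!AP => Ai Aj; apply: dA => //; by exists x.
- case=> [|i s] /=; last exact: (scheme_tree (sP i)).
  split=> [[i /(scheme_tree (sP i))[x]]|[x [i _ Ax]]].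
    by rewrite -AP => Ax; exists x, i.
  by exists i; apply/(scheme_tree (sP i)); exists x; rewrite -AP.
- move=> a aP; have [n|x xP] := scheme_complete (sP (a 0)) (a := fun k => a k.+1).
    by have := aP n.+1; rewrite node_scheme_mkseq.
  exists x => -[|n]; last by rewrite node_scheme_mkseq.
  by exists (a 0) => //; exact: PA (xP 0).
- move=> a x y xP yP; apply: (scheme_sep (sP (a 0)) (a := fun k => a k.+1)) => n.
  + by have := xP n.+1; rewrite node_scheme_mkseq.
  + by have := yP n.+1; rewrite node_scheme_mkseq.
- move=> a x U xP xU; have [n|n nU] :=
    scheme_cvg (sP (a 0)) (a := fun k => a k.+1) _ xU.
    by have := xP n.+1; rewrite node_scheme_mkseq.
  by exists n.+1; rewrite node_scheme_mkseq.
Qed.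

Lemma scheme_preimage (X W : topologicalType) (j : W -> X) (A : set X) t :
  continuous j -> injective j ->
  (forall x U, nbhs x U -> exists2 V, nbhs (j x) V & j @^-1` V `<=` U) ->
  A `<=` range j -> has_scheme A t -> has_scheme (j @^-1` A) t.
Proof.
move=> cj ij nj Aj [P sP].
have PA s x : P s x -> A x.
  elim/last_ind: s => [|s k IH] Psx; first by rewrite -(scheme_root sP).
  by apply: IH; apply/(scheme_split sP); exists k.
exists (fun s => j @^-1` P s); split.
- by rewrite (scheme_root sP).
- move=> s; apply: open_comp; [by move=> *; exact: cj|exact: scheme_open sP _].
- by move=> s x; exact: (scheme_split sP).
- by move=> s i k x; exact: (scheme_disj sP).
- move=> s; split=> [/(scheme_tree sP)[x Px]|[x Px]]; last first.
    by apply/(scheme_tree sP); exists (j x).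
  by have [w _ wx] := Aj _ (PA _ _ Px); exists w; rewrite /= wx.
- move=> a aP; have [n|x xP] := scheme_complete sP (a := a).
    by have [x] := aP n; exists (j x).
  have [w _ wx] := Aj _ (PA _ _ (xP 0)); exists w => n; rewrite /= wx; exact: xP.
- by move=> a x y xP yP; apply: ij; exact: (scheme_sep sP xP yP).
- move=> a x U xP /nj[V xV VU]; have [n nV] := scheme_cvg sP xP xV.
  by exists n => y /nV; exact: VU.
Qed.

Lemma scheme_image (X W : topologicalType) (j : W -> X) (A : set W) t :
  continuous j -> injective j -> (forall U, open U -> open (j @` U)) ->
  has_scheme A t -> has_scheme (j @` A) t.
Proof.
move=> cj ij oj [P sP].
have jP s x : (j @` P s) (j x) -> P s x by move=> [y Py /ij <-].
exists (fun s => j @` P s); split.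
- by rewrite (scheme_root sP).
- by move=> s; apply: oj; exact: scheme_open sP _.
- move=> s x; split=> [[y /(scheme_split sP)[i Pi] <-]|[i [y Py <-]]].
    by exists i, y.
  by exists y => //; apply/(scheme_split sP); exists i.
- move=> s i k _ [x Px <-] /jP; exact: (scheme_disj sP).
- move=> s; split=> [/(scheme_tree sP)[x Px]|[_ [x Px _]]].
    by exists (j x), x.
  by apply/(scheme_tree sP); exists x.
- move=> a aP; have [n|x xP] := scheme_complete sP (a := a).
    by have [_ [x Px _]] := aP n; exists x.
  by exists (j x) => n; exists x.
- move=> a x y xP yP; have [x' _ xE] := xP 0; have [y' _ yE] := yP 0.
  rewrite -{}xE -{}yE in xP yP *; congr j.
  by apply: (scheme_sep sP (a := a)) => n; exact: jP.
- move=> a x U xP xU; have [x' _ xE] := xP 0; rewrite -{}xE in xP xU *.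
  have [n nV] := scheme_cvg sP (fun n => jP _ _ (xP n)) (cj _ _ xU).
  by exists n => _ [y /nV ? <-].
Qed.

Definition tree_in (D : set nat) : set (seq nat) :=
  [set s | forall i, i < size s -> D (nth 0 s i)].

Lemma tree_in_rcons D s i : tree_in D (rcons s i) <-> tree_in D s /\ D i.
Proof.
split=> [h|[h Di] k].
  split=> [k ks|]; last first.
    by have := h (size s); rewrite size_rcons nth_rcons ltnn eqxx; exact.
  by have := h k; rewrite size_rcons nth_rcons ks; apply; exact: ltnW.
rewrite size_rcons ltnS leq_eqVlt => /predU1P[->|ks].
  by rewrite nth_rcons ltnn eqxx.
by rewrite nth_rcons ks; exact: h.
Qed.

(** The index lists the choices from the last to the first, so that the recursion
    follows the list. The intersection keeps children inside their parent
    even where [pc] is applied to a set that it does not split. *)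
Fixpoint level_nodes T (A : set T) (pc : nat -> set T -> nat -> set T)
    (r : seq nat) : set T :=
  if r is i :: r' then
    level_nodes A pc r' `&` pc (size r') (level_nodes A pc r') i
  else A.

(** Builds a scheme by splitting one level at a time. [Inv] is what holds of the
    nonempty nodes, and R n is the condition imposed on the nodes of level
    n + 1 so that branches converge. *)
Lemma level_scheme (X : topologicalType) (A : set X) (D : set nat)
    (Inv : set (set X)) (R : nat -> set (set X)) :
  hausdorff_space X ->
  Inv A -> (forall V, Inv V -> open V /\ V !=set0) ->
  (forall n V, Inv V -> exists pc : nat -> set X,
    [/\ trivIset setT pc, \bigcup_i pc i = V,
        forall i, D i -> Inv (pc i) /\ R n (pc i)
      & forall i, ~ D i -> pc i = set0]) ->
  (forall U : nat -> set X, (forall n, Inv (U n)) ->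
    (forall n, U n.+1 `<=` U n) -> (forall n, R n (U n.+1)) ->
    exists x, (forall n, U n x) /\
      forall W, nbhs x W -> exists n, U n `<=` W) ->
  has_scheme A (tree_in D).
Proof.
move=> hX IA Iop Isplit Icvg.
have /choice[pc0 pc0P] : forall nV : nat * set X, exists pc : nat -> set X,
    Inv nV.2 ->
    [/\ trivIset setT pc, \bigcup_i pc i = nV.2,
        forall i, D i -> Inv (pc i) /\ R nV.1 (pc i)
      & forall i, ~ D i -> pc i = set0].
  move=> [n V]; have [/(Isplit n)[pc pcP]|nI] := pselect (Inv V).
    by exists pc.
  by exists (fun=> set0).
pose pc n V := pc0 (n, V).
pose P s := level_nodes A pc (rev s).
have PS s i : P (rcons s i) = P s `&` pc (size s) (P s) i.
  by rewrite /P rev_rcons /= size_rev.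
have IP s : tree_in D s -> Inv (P s).
  elim/last_ind: s => [//|s i IH] /tree_in_rcons[Ds Di].
  have [_ pcU pcI _] := pc0P (size s, P s) (IH Ds); have [Ii _] := pcI _ Di.
  rewrite PS setIidr//=.
  by rewrite -[X in _ `<=` X]pcU; exact: bigcup_sup.
have PP s i : tree_in D s -> P (rcons s i) = pc (size s) (P s) i.
  move=> Ds; rewrite PS setIidr//.
  have [_ pcU _ _] := pc0P (size s, P s) (IP _ Ds).
  by rewrite -[X in _ `<=` X]pcU; exact: bigcup_sup.
have P0 s : ~ tree_in D s -> P s = set0.
  elim/last_ind: s => [|s i IH]; first by case.
  have [Ds nD|Ds _] := pselect (tree_in D s); last by rewrite PS IH// set0I.
  have Di : ~ D i by move=> Di; apply: nD; exact/tree_in_rcons.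
  by rewrite PP//; have [_ _ _ h] := pc0P (size s, P s) (IP _ Ds); exact: h.
have treeP s : tree_in D s <-> P s !=set0.
  split=> [/IP/Iop[]//|Ps]; apply: contrapT => /P0 Ps0.
  by move: Ps; rewrite Ps0 => -[].
have cvgP (a : nat -> nat) : (forall n, P (mkseq a n) !=set0) ->
    exists x, (forall n, P (mkseq a n) x) /\
      forall W, nbhs x W -> exists n, P (mkseq a n) `<=` W.
  move=> /(_ _)/treeP aP; apply: Icvg => n; first exact/IP/aP.
    by rewrite mkseqS PS; exact: subIsetl.
  have /tree_in_rcons[_ Da] : tree_in D (rcons (mkseq a n) (a n)).
    by rewrite -mkseqS.
  rewrite mkseqS PP//.
  have [_ _ /(_ _ Da)[_ +] _] := pc0P (size (mkseq a n), P (mkseq a n)) (IP _ (aP _)).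
  by rewrite {1}size_mkseq.
have sepP (a : nat -> nat) x y : (forall n, P (mkseq a n) x) ->
    (forall n, P (mkseq a n) y) -> x = y.
  move=> xP yP; have [n|z [zP zW]] := cvgP a; first by exists x.
  suff zE w : (forall n, P (mkseq a n) w) -> z = w by rewrite -(zE x)// -(zE y).
  move=> wP; apply: hX => V W Vz Ww; have [n nV] := zW _ Vz.
  by exists w; split; [exact: nV|exact: nbhs_singleton].
exists P; split=> //.
- move=> s; have [/IP/Iop[]//|/P0->] := pselect (tree_in D s); exact: open0.
- move=> s x; split=> [Px|[i]]; last by rewrite PS => -[].
  have Ds : tree_in D s by apply/treeP; exists x.
  have [_ /= pcU _ _] := pc0P (size s, P s) (IP _ Ds).
  by move: (Px); rewrite -{1}pcU => -[i _ ix]; exists i; rewrite PP.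
- move=> s i j x Pi Pj.
  have Ds : tree_in D s.
    by apply/treeP; exists x; move: Pi; rewrite PS => -[].
  have [pcD _ _ _] := pc0P (size s, P s) (IP _ Ds).
  by move: Pi Pj; rewrite !PP// => Pi Pj; apply: (pcD i j) => //; exists x.
- by move=> a /cvgP[x [xP _]]; exists x.
- move=> a x U xP xU; have [n|z [zP zW]] := cvgP a; first by exists x.
  by apply: zW; rewrite (sepP a z x).
Qed.

(** * Existence of schemes *)

Lemma nested_le T (U : nat -> set T) :
  (forall n, U n.+1 `<=` U n) -> forall m n, m <= n -> U n `<=` U m.
Proof.
move=> dU m; elim=> [|n IH]; first by rewrite leqn0 => /eqP->.
rewrite leq_eqVlt => /predU1P[->//|/IH]; exact: subset_trans (dU n).
Qed.

Lemma nested_filter T (U : nat -> set T) :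
  (forall n, U n.+1 `<=` U n) -> (forall n, U n !=set0) ->
  ProperFilter (filter_from setT U).
Proof.
move=> /nested_le dU U0; apply: filter_from_proper => //.
apply: filter_from_filter; first by exists 0.
move=> m n _ _; exists (maxn m n) => // x Ux.
by split; apply: dU Ux; rewrite ?leq_maxl ?leq_maxr.
Qed.

Definition nat_base (X : topologicalType) (B : nat -> set X) :=
  (forall n, open (B n)) /\
  forall x U, nbhs x U -> exists n, B n x /\ B n `<=` U.

Definition crowded (X : topologicalType) :=
  forall U : set X, open U -> U !=set0 -> exists x y, [/\ U x, U y & x <> y].

Lemma bigsetU_clopen (X : topologicalType) (F : nat -> set X) n :
  (forall i, clopen (F i)) -> clopen (\big[setU/set0]_(i < n) F i).
Proof.
by move=> cF; elim/big_ind: _ => //; [exact: clopen0|exact: clopenU].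
Qed.

Lemma bigsetU_compact (X : topologicalType) (F : nat -> set X) n :
  (forall i, compact (F i)) -> compact (\big[setU/set0]_(i < n) F i).
Proof.
by move=> cF; elim/big_ind: _ => //; [exact: compact0|exact: compactU].
Qed.

(** Disjointification of the cover F leaves infinitely many nonempty pieces as
    soon as no finite part of F covers V; these are then renumbered. *)
Lemma clopen_infinite_partition (X : topologicalType) (V : set X)
    (F : nat -> set X) :
  (forall n, clopen (F n)) -> \bigcup_n F n = V ->
  (forall n, ~ V `<=` \big[setU/set0]_(i < n) F i) ->
  exists W : nat -> set X, [/\ trivIset setT W, \bigcup_i W i = V &
    forall i, [/\ clopen (W i), W i !=set0 & exists n, W i `<=` F n]].
Proof.
move=> cF FV nF; pose N := [set n | seqDU F n !=set0].
have Ninf : infinite_set N.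
  move=> /finite_fsetP[s sN]; pose n := (\max_(i <- finmap.enum_fset s) i).+1.
  apply: (nF n); rewrite -FV (seqDU_bigcup_eq F) => x [k _ kx].
  have ks : k \in finmap.enum_fset s.
    by have : N k by [exists x]; rewrite sN.
  rewrite bigsetU_seqDU -bigcup_mkord; exists k => //=.
  by rewrite /n ltnS; exact: (@leq_bigmax_seq _ _ predT id).
have /card_esym/card_set_bijP[f [fN fi fs]] : (N #= [set: nat])%card.
  exact: eq_card_nat.
exists (fun i => seqDU F (f i)); split.
- move=> i j _ _ ij; apply: fi; rewrite ?in_setT//.
  by apply: (@trivIset_seqDU _ F).
- rewrite -FV (seqDU_bigcup_eq F); apply/seteqP; split=> x [i _ ix].
    by exists (f i).
  by have [|j _ ji] := fs i; [exists x|exists j; rewrite ?ji].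
- move=> i; split; [|exact: fN|by exists (f i); exact: subset_seqDU].
  rewrite /seqDU setDE; apply: clopenI => //; apply: clopenC => //.
  exact: bigsetU_clopen.
Qed.

(** At level n every node is cut by the n-th base set if it properly meets it, and
    by any base set that cuts it otherwise. So a node of level n + 1 is inside
    B n or disjoint from it, and this suffices for branches to converge, as a
    branch has a point by compactness. *)
Lemma compact_scheme (X : topologicalType) (B : nat -> set X) (A : set X) :
  hausdorff_space X -> nat_base B -> (forall n, clopen (B n)) -> crowded X ->
  compact A -> open A -> A !=set0 -> has_scheme A (tree_in `I_2).
Proof.
move=> hX [oB bB] cB crX cA oA A0.
apply: (@level_scheme X A `I_2 [set V | [/\ clopen V, V !=set0 & V `<=` A]]
  (fun n W => W `<=` B n \/ W `&` B n = set0)) => //.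
- by split=> //; split=> //; exact: compact_closed.
- by move=> V [[]].
- move=> n V [cV V0 VA].
  suff [W [cW [x Wx] [y Wy] WV WB]] : exists W, [/\ clopen W, W `&` V !=set0,
      ~` W `&` V !=set0, True & forall U, U = W `&` V \/ U = ~` W `&` V ->
      U `<=` B n \/ U `&` B n = set0].
    exists (fun i => if i is 0 then W `&` V else if i is 1 then ~` W `&` V
      else set0); split.
    + move=> [|[|i]] [|[|j]] _ _ //= [z [zi zj]] //.
      * by case: zi zj => [? _] [].
      * by case: zi zj => [? _] [].
    + apply/seteqP; split=> [z [[|[|i]] _ []]//|z Vz].
      by have [Wz|Wz] := pselect (W z); [exists 0|exists 1].
    + move=> [|[|//]] _; (split; [split|apply: WB; by [left|right]]).
      * exact: clopenI.
      * by exists x.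
      * by move=> z [_ /VA].
      * by apply: clopenI => //; exact: clopenC.
      * by exists y.
      * by move=> z [_ /VA].
    + by move=> [|[|i]] // nI; exfalso; exact: nI.
  have [x [y [Vx Vy xy]]] := crX V cV.1 V0.
  have [m [mx my]] : exists m, B m x /\ B m `<=` ~` [set y].
    apply: bB; apply: open_nbhs_nbhs; split=> //.
    exact/closed_openC/accessible_closed_set1/hausdorff_accessible.
  (* If B n does not cut V, any clopen set separating two points of V does. *)
  have triv : V `<=` B n \/ V `&` B n = set0 -> exists W, [/\ clopen W,
      W `&` V !=set0, ~` W `&` V !=set0, True & forall U, U = W `&` V \/
      U = ~` W `&` V -> U `<=` B n \/ U `&` B n = set0].
    move=> VB; exists (B m); split=> //; [by exists x| |].
      by exists y; split=> // /my; exact.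
    move=> U UE; have UV : U `<=` V by case: UE => -> z [].
    case: VB => VB; [left|right]; first exact: subset_trans UV VB.
    by apply/seteqP; split=> // z [/UV Vz Bz]; rewrite -VB.
  have [VB|/nonsubset[z [Vz nBz]]] := pselect (V `<=` B n); first by apply: triv; left.
  have [VB|/eqP/set0P[w [Vw Bw]]] := pselect (V `&` B n = set0).
    by apply: triv; right.
  exists (B n); split=> //; [by exists w|by exists z|].
  move=> U [->|->]; [by left; exact: subIsetl|right].
  by rewrite setIAC setICl set0I.
- move=> U IU decU RU.
  have [x xU] : exists x, forall n, U n x.
    have UF : ProperFilter (filter_from setT U).
      by apply: nested_filter => // n; have [] := IU n.
    have [|x [_ xU]] := cA (filter_from setT U).
      by exists 0 => //; have [] := IU 0.
    exists x => n; have [[_ cU] _ _] := IU n; apply: cU => V xV.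
    by apply: xU => //; exists n.
  exists x; split=> // W xW; have [n [nx nW]] := bB _ _ xW.
  exists n.+1; apply: subset_trans nW; case: (RU n) => // /seteqP[/(_ x) + _].
  by case; split.
Qed.

Definition keep_if T (Q : Prop) (A : set T) : set T := [set x | Q /\ A x].

Lemma keep_if_ind T (P : set T -> Prop) (Q : Prop) (A : set T) :
  P set0 -> (Q -> P A) -> P (keep_if Q A).
Proof.
move=> P0 PA; have [q|nq] := pselect Q.
  have -> : keep_if Q A = A by apply/seteqP; split=> x //; case.
  exact: PA.
by have -> : keep_if Q A = set0 by apply/seteqP; split=> x //; case.
Qed.

(** A is a disjoint union of infinitely many compact open pieces, each of which
    has a binary scheme. *)
Lemma locally_compact_scheme (X : topologicalType) (B : nat -> set X)
    (A : set X) :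
  hausdorff_space X -> nat_base B -> (forall n, clopen (B n)) -> crowded X ->
  (forall x, A x -> exists n, [/\ B n x, B n `<=` A & compact (B n)]) ->
  ~ compact A -> has_scheme A (node_tree (fun=> tree_in `I_2)).
Proof.
move=> hX bB cB crX lcA ncA.
pose F n := keep_if (B n `<=` A /\ compact (B n)) (B n).
have FA : \bigcup_n F n = A.
  apply/seteqP; split=> [x [n _ [[nA _] /nA//]]|x /lcA[n [nx nA cn]]].
  by exists n.
have cF n : compact (F n).
  by apply: keep_if_ind => [|[]//]; exact: compact0.
have coF n : clopen (F n).
  by apply: keep_if_ind => //; exact: clopen0.
have [|W [dW WA WP]] := clopen_infinite_partition coF FA.
  move=> n AF; apply: ncA.
  suff -> : A = \big[setU/set0]_(i < n) F i by exact: bigsetU_compact.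
  apply/seteqP; split=> //; rewrite -FA -bigcup_mkord => x [k _ kx].
  by exists k.
rewrite -WA; apply: has_scheme_node => // i.
have [[oW cW] W0 [n Wn]] := WP i.
apply: (compact_scheme (B := B)) => //.
exact: subclosed_compact Wn.
Qed.

(** A sequence of covers such that filters with members of every cover converge
    in Z. For metrizable spaces this amounts to complete metrizability, and it
    avoids the choice of a metric on products and subspaces. *)
Definition complete_sieve (X : topologicalType) (Z : set X)
    (O : nat -> set (set X)) :=
  (forall n z, Z z -> exists U, O n U /\ nbhs z U) /\
  forall F : set_system X, ProperFilter F -> F Z ->
    (forall n, exists U, O n U /\ F U) -> exists z, Z z /\ F --> z.

(** A nonempty clopen piece V is never compact. A filter on V without cluster
    point gives a cover of V by small clopen sets, each missing some member of
    the filter; no finite part of it covers V, hence V splits into infinitely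
    many small pieces. *)
Lemma nowhere_locally_compact_scheme (X : topologicalType) (B : nat -> set X)
    (A : set X) O :
  hausdorff_space X -> nat_base B -> (forall n, clopen (B n)) ->
  clopen A -> A !=set0 -> complete_sieve A O ->
  (forall x K, A x -> nbhs x K -> ~ compact K) ->
  has_scheme A (tree_in setT).
Proof.
move=> hX [oB bB] cB cA A0 [Ocov Ocvg] nc.
apply: (@level_scheme X A setT [set V | [/\ clopen V, V !=set0 & V `<=` A]]
  (fun n W => exists U, O n U /\ W `<=` U)) => //.
- by split.
- by move=> V [[]].
- move=> n V [cV V0 VA].
  have [x Vx] := V0.
  have := nc x V (VA _ Vx) (open_nbhs_nbhs (conj cV.1 Vx)).
  move=> /existsNP[F /not_implyP[pF /not_implyP[FV nF]]].
  pose G k := [/\ B k `<=` V, exists U, O n U /\ B k `<=` U &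
    exists S, F S /\ S `&` B k = set0].
  pose C k := keep_if (G k) (B k).
  have [| | |W [dW WV WP]] := @clopen_infinite_partition X V C.
  + by move=> k; apply: keep_if_ind => //; exact: clopen0.
  + apply/seteqP; split=> [y [k _ [[kV _ _] /kV//]]|y Vy].
    have [S [U [FS yU SU]]] : exists S U, [/\ F S, nbhs y U & S `&` U = set0].
      apply: contrapT => H; apply: nF; exists y; split=> // S U FS yU.
      apply/set0P/eqP => SU; apply: H; by exists S, U.
    have [N [ON yN]] := Ocov n y (VA _ Vy).
    have [k [ky kU]] := bB y (V `&` (U `&` N))
      (filterI (open_nbhs_nbhs (conj cV.1 Vy)) (filterI yU yN)).
    exists k => //; split=> //; split.
    * by move=> z /kU[].
    * by exists N; split=> // z /kU[_ []].
    * exists S; split=> //; apply/seteqP; split=> // z [Sz /kU[_ [Uz _]]].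
      by rewrite -SU.
  + move=> m VC.
    have FC k : F (~` C k).
      apply: (@keep_if_ind _ (fun S => F (~` S))) => [|[_ _ [S [FS SB]]]].
        by rewrite setC0; exact: filterT.
      by apply: filterS FS => z Sz Bz; have : (S `&` B k) z by []; rewrite SB.
    have FmC : F (~` \big[setU/set0]_(i < m) C i).
      elim/big_ind: _; [by rewrite setC0; exact: filterT| |by move=> i _; exact: FC].
      by move=> S T FS FT; rewrite setCU; exact: filterI.
    have [z [/VC]//] := filter_ex (filterI FV FmC).
  exists W; split=> // i; [move=> _|by case]; have [cW W0 [k kC]] := WP i.
  have [z /kC[[kV [U [OU kU]] _] _]] := W0.
  have Wk : W i `<=` B k by move=> y /kC[].
  split; [split=> //|exists U; split=> //]; last exact: subset_trans kU.
  exact: subset_trans (subset_trans Wk kV) VA.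
- move=> U IU decU RU.
  have UF : ProperFilter (filter_from setT U).
    by apply: nested_filter => // n; have [] := IU n.
  have [||x [Ax xU]] := Ocvg (filter_from setT U).
  + by exists 0 => //; have [] := IU 0.
  + by move=> n; have [V [OV VU]] := RU n; exists V; split=> //; exists n.+1.
  exists x; split=> [n|W /xU [n _ nW]]; last by exists n.
  have [[_ cU] _ _] := IU n; apply: cU => V /xU[m _ mV].
  have [y Uy] : U (maxn m n) !=set0 by have [] := IU (maxn m n).
  by exists y; split; [|apply: mV]; apply: (nested_le decU) Uy;
     rewrite ?leq_maxl ?leq_maxr.
Qed.

(** * Schemes of the five spaces *)

Section cylinders.
Variables (V : uniformType).
Hypothesis dV : forall v : V, nbhs v [set v].
Local Notation S := (prod_topology (fun _ : nat => V)).

Definition agree n (a : S) : set S := [set b | forall k, k < n -> b k = a k].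

Lemma nbhs_agree n (a : S) : nbhs a (agree n a).
Proof.
elim: n => [|n IH]; first exact: filterS filterT.
have : nbhs a [set b : S | b n = a n].
  exact: (@proj_continuous nat (fun=> V) n a _ (dV (a n))).
move=> /(filterI IH); apply: filterS => b [bn bN] k.
by rewrite ltnS leq_eqVlt => /predU1P[->|/bn].
Qed.

Lemma agree_base (a : S) U : nbhs a U -> exists n, agree n a `<=` U.
Proof.
pose F := filter_from setT (agree ^~ a).
have FF : Filter F.
  apply: filter_from_filter; first by exists 0.
  move=> m n _ _; exists (maxn m n) => // b ab; split=> k kmn; apply: ab.
    by rewrite leq_max kmn.
  by rewrite leq_max kmn orbT.
suff : F --> a by move=> Fa /Fa[n _ nU]; exists n.
apply/pointwise_cvgP => t W tW; exists t.+1 => // b /(_ t (ltnSn t)) /= ->.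
exact: nbhs_singleton.
Qed.

Definition cyl (s : seq V) : set S := [set b | mkseq b (size s) = s].

Lemma agree_mkseq (a b : S) n : agree n a b <-> mkseq b n = mkseq a n.
Proof.
elim: n => [|n IH]; first by [].
rewrite !mkseqS; split=> [ab|/rcons_inj[/IH ab E] k].
  rewrite ab//; congr rcons; apply/IH => k kn; apply: ab; exact: ltnW.
by rewrite ltnS leq_eqVlt => /predU1P[->|/ab].
Qed.

Lemma cyl_open s : open (cyl s).
Proof.
rewrite openE => a sa; apply: filterS (nbhs_agree (size s) a) => b.
by move=> /agree_mkseq; rewrite sa.
Qed.

Lemma cyl_clopen s : clopen (cyl s).
Proof.
split; first exact: cyl_open.
rewrite -openC openE => a sa; apply: filterS (nbhs_agree (size s) a) => b.
by move=> /agree_mkseq; rewrite /cyl /= => -> /sa.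
Qed.

Lemma cyl_mkseq (a b : S) n : cyl (mkseq a n) b <-> agree n a b.
Proof. by rewrite agree_mkseq /cyl/= size_mkseq. Qed.

End cylinders.

Lemma nbhs_nat (v : nat) : nbhs v [set v].
Proof. exact: discrete_set1. Qed.
Lemma nbhs_bool (v : bool) : nbhs v [set v].
Proof. exact: discrete_set1. Qed.

Lemma baire_scheme : has_scheme [set: baire_space] (tree_in setT).
Proof.
have mE (a : nat -> nat) x : (forall n, cyl (mkseq a n) x) -> x = a.
  move=> xP; apply/funext => k; have /cyl_mkseq := xP k.+1; exact.
exists (@cyl nat); split.
- by apply/seteqP.
- exact: cyl_open nbhs_nat.
- move=> s x; rewrite /cyl; split=> [/= <-|[i]].
    by exists (x (size s)); rewrite /= size_rcons size_mkseq mkseqS.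
  by rewrite /= size_rcons mkseqS => /rcons_inj[].
- move=> s i j x; rewrite /cyl /= !size_rcons !mkseqS.
  by move=> /rcons_inj[_ <-] /rcons_inj[].
- by move=> s; split=> // _; exists (nth 0 s); rewrite /cyl/= mkseq_nth.
- by move=> a _; exists a => n; rewrite /cyl/= size_mkseq.
- by move=> a x y /mE-> /mE.
- move=> a x U /mE-> /(agree_base (V := nat)) [n nU]; exists n => y /cyl_mkseq.
  exact: nU.
Qed.

Definition flat (I : countType) T (C : I -> set T) (n : nat) : set T :=
  if unpickle n is Some i then C i else set0.

Lemma flat_pickle (I : countType) T (C : I -> set T) i : flat C (pickle i) = C i.
Proof. by rewrite /flat pickleK. Qed.

Lemma flat_ind (I : countType) T (C : I -> set T) (P : set T -> Prop) :
  P set0 -> (forall i, P (C i)) -> forall n, P (flat C n).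
Proof. by move=> P0 PC n; rewrite /flat; case: unpickle. Qed.

Lemma nat_base_flat (X : topologicalType) (I : countType) (C : I -> set X) :
  (forall i, open (C i)) ->
  (forall x U, nbhs x U -> exists i, C i x /\ C i `<=` U) -> nat_base (flat C).
Proof.
move=> oC bC; split=> [n|x U /bC[i Ci]]; first by apply: flat_ind => //; exact: open0.
by exists (pickle i); rewrite flat_pickle.
Qed.

Lemma cantor_base : nat_base (flat (@cyl bool)).
Proof.
apply: nat_base_flat => [s|x U /(agree_base (V := bool))[n nU]].
  exact: cyl_open nbhs_bool _.
exists (mkseq x n); split; first by rewrite /cyl/= size_mkseq.
by move=> y /cyl_mkseq/nU.
Qed.

Lemma cantor_base_clopen n : clopen (flat (@cyl bool) n).
Proof.
by apply: flat_ind => [|s]; [exact: clopen0|exact: cyl_clopen nbhs_bool _].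
Qed.

Lemma cantor_crowded : crowded cantor_space.
Proof.
move=> U oU [x Ux]; have [n nU] := agree_base (open_nbhs_nbhs (conj oU Ux)).
exists x, (fun k => if k < n then x k else ~~ x k); split=> //.
  by apply: nU => k kn /=; rewrite kn.
by move=> /(congr1 (@^~ n)); rewrite ltnn; case: (x n).
Qed.

Lemma cantor_scheme : has_scheme [set: cantor_space] (tree_in `I_2).
Proof.
apply: (compact_scheme cantor_space_hausdorff cantor_base) => //.
- exact: cantor_base_clopen.
- exact: cantor_crowded.
- exact: cantor_space_compact.
- exact: openT.
- by exists (fun=> false).
Qed.

(** The punctured space is not compact, since the removed point is not
    isolated. *)
Lemma punctured_cantor_scheme :
  has_scheme [set: punctured_cantor_space] (node_tree (fun=> tree_in `I_2)).
Proof.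
set A := ~` [set (fun=> false) : cantor_space].
have cA : open A.
  apply: closed_openC; apply: accessible_closed_set1.
  exact: hausdorff_accessible cantor_space_hausdorff.
have -> : [set: punctured_cantor_space] = @set_val _ A @^-1` A.
  apply/seteqP; split=> // x _; exact: (set_valP x).
apply: scheme_preimage.
- exact: initial_continuous.
- exact: val_inj.
- move=> x U [_ [[V oV <-] /= Vx VU]]; exists V => //.
  exact: open_nbhs_nbhs.
- by move=> x Ax; exists (SigSub (mem_set Ax)).
apply: (locally_compact_scheme cantor_space_hausdorff cantor_base).
- exact: cantor_base_clopen.
- exact: cantor_crowded.
- move=> x Ax; have [n [nx nA]] := cantor_base.2 x A (open_nbhs_nbhs (conj cA Ax)).
  exists n; split=> //; apply: (subclosed_compact _ cantor_space_compact) => //.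
  by have [] := cantor_base_clopen n.
- move=> /(compact_closed cantor_space_hausdorff).
  rewrite /A closedC => o1.
  have [|x [y [-> ->]]//] := cantor_crowded o1; by exists (fun=> false).
Qed.

(** Two pieces, padded with empty ones. *)
Definition sum_tree (t1 t2 : set (seq nat)) : set (seq nat) :=
  node_tree (fun i => match i with 0 => t1 | 1 => t2 | _ => set0 end).

Lemma has_scheme_disjoint_union (X : topologicalType) (A B : set X) t1 t2 :
  A `&` B = set0 -> has_scheme A t1 -> has_scheme B t2 ->
  has_scheme (A `|` B) (sum_tree t1 t2).
Proof.
move=> AB sA sB.
pose C i := match i with 0 => A | 1 => B | _ => set0 end.
have -> : A `|` B = \bigcup_i C i.
  apply/seteqP; split=> [x [Ax|Bx]|x [[|[|i]] _ //]]; [by exists 0|by exists 1| |].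
    by left.
  by right.
apply: has_scheme_node => [|[|[|i]]//]; last exact: has_scheme0.
by move=> [|[|i]] [|[|j]] _ _ //= [x [/= a b]] //; suff : set0 x by []; rewrite -AB.
Qed.

Lemma sum_scheme (S T : topologicalType) t1 t2 :
  has_scheme [set: S] t1 -> has_scheme [set: T] t2 ->
  has_scheme [set: topological_sum S T] (sum_tree t1 t2).
Proof.
move=> sS sT; pose Y (b : bool) : topologicalType := if b then S else T.
have img b t : has_scheme [set: Y b] t ->
    has_scheme (existT Y b @` setT : set (topological_sum S T)) t.
  apply: scheme_image.
  - exact: (@existT_continuous _ Y).
  - by move=> x y; exact/Eqdep_dec.inj_pair2_eq_dec/Bool.bool_dec.
  - exact: (@existT_open_map _ Y).
have -> : [set: topological_sum S T] =
    (existT Y true @` setT) `|` (existT Y false @` setT).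
  apply/seteqP; split=> // -[[] x] _; [left|right]; by exists x.
apply: has_scheme_disjoint_union; [|exact: (img true)|exact: (img false)].
by apply/seteqP; split=> // _ [[x _ <-] [y _]].
Qed.

(** * Classification from the points of local compactness *)

Lemma complete_sieve_closed (X : topologicalType) (Z : set X) O :
  complete_sieve [set: X] O -> closed Z -> complete_sieve Z O.
Proof.
move=> [Ocov Ocvg] cZ; split=> [n z _|F pF FZ FO]; first exact: Ocov.
have [z [_ Fz]] := Ocvg F pF filterT FO; exists z; split=> //.
apply: cZ => U /Fz FU; exact: filter_ex (filterI FZ FU).
Qed.

Definition lcompact_points (X : topologicalType) : set X :=
  [set x | exists K, nbhs x K /\ compact K].

Lemma open_lcompact_points (X : topologicalType) : open (@lcompact_points X).
Proof.
rewrite openE => x [K [xK cK]].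
by move: xK => /nbhs_interior; apply: filterS => y yK; exists K.
Qed.

Lemma crowded_classification (X : topologicalType) (B : nat -> set X) O :
  hausdorff_space X -> nat_base B -> (forall n, clopen (B n)) -> crowded X ->
  [set: X] !=set0 -> complete_sieve [set: X] O ->
  closed (@lcompact_points X) ->
  homeomorphic X cantor_space \/
  homeomorphic X baire_space \/
  homeomorphic X punctured_cantor_space \/
  homeomorphic X (topological_sum baire_space cantor_space) \/
  homeomorphic X (topological_sum baire_space punctured_cantor_space).
Proof.
move=> hX bB cB crX X0 sX; set L := @lcompact_points X => cL.
have oL : open L := @open_lcompact_points X.
have sL : L !=set0 -> has_scheme L (tree_in `I_2) \/
    has_scheme L (node_tree (fun=> tree_in `I_2)).
  have [cptL L0|ncL _] := pselect (compact L); [left|right].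
    exact: (compact_scheme hX bB).
  apply: (locally_compact_scheme hX bB) => // x [K [xK cK]].
  have Lx : L x by exists K.
  have [n [nx nU]] := bB.2 _ _ (filterI xK (open_nbhs_nbhs (conj oL Lx))).
  exists n; split=> // [y /nU[]//|].
  apply: (subclosed_compact (cB n).2 cK) => y /nU[]//.
have sN : ~` L !=set0 -> has_scheme (~` L) (tree_in setT).
  move=> N0; apply: (nowhere_locally_compact_scheme hX bB) => //.
  - by split; [exact: closed_openC|exact: open_closedC].
  - by apply: complete_sieve_closed sX _; exact: open_closedC.
  - by move=> x K nLx xK cK; apply: nLx; exists K.
have [/eqP L0|/eqP/set0P L0] := pselect (L = set0).
  right; left; apply: scheme_homeomorphic baire_scheme.
  by rewrite -setC0 -(eqP L0); apply: sN; rewrite (eqP L0) setC0.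
have [/eqP N0|/eqP/set0P N0] := pselect (~` L = set0).
  have LT : L = setT by rewrite -[L]setCK (eqP N0) setC0.
  move: sL; rewrite LT => -[//|sL|sL]; [left|do 2 right; left].
    exact: scheme_homeomorphic cantor_scheme.
  exact: scheme_homeomorphic punctured_cantor_scheme.
have NL : [set: X] = ~` L `|` L by rewrite setUC setUv.
have NLI : ~` L `&` L = set0 by rewrite setIC setICr.
do 3 right; case: (sL L0) => [{}sL|{}sL]; [left|right];
  have := has_scheme_disjoint_union NLI (sN N0) sL; rewrite -NL => sX';
  apply: scheme_homeomorphic sX' _; apply: sum_scheme.
- exact: baire_scheme.
- exact: cantor_scheme.
- exact: baire_scheme.
- exact: punctured_cantor_scheme.
Qed.

(** * Homeomorphism invariant sets in CDH spaces *)

Lemma countable_setU T (A B : set T) :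
  countable A -> countable B -> countable (A `|` B).
Proof.
move=> cA cB; rewrite -bigcup2E; apply: bigcup_countable => // i _.
by rewrite /bigcup2; case: ifP => // _; case: ifP.
Qed.

Lemma countable_sub_range T (f : nat -> T) (A : set T) :
  A `<=` range f -> countable A.
Proof.
move=> Af; apply: (sub_countable (subset_card_le Af)).
exact: (sub_countable (card_image_le f setT)).
Qed.

Lemma countable_preimage T U (f : T -> U) (A : set U) :
  injective f -> countable A -> countable (f @^-1` A).
Proof.
move=> fi; apply: sub_countable.
have fi' : {in f @^-1` A &, injective f} by move=> x y _ _ /fi.
have /card_eqPle[_ h] := inj_card_eq fi'.
by apply: (card_le_trans h); apply: subset_card_le; exact: image_preimage_subset.
Qed.

Lemma countable_enum T (x0 : T) (A : set T) : countable A ->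
  exists f : nat -> T, A `<=` range f.
Proof.
move=> /countable_injP[g gi].
have /choice[f fP] : forall n, exists x, forall y, A y -> g y = n -> x = y.
  move=> n; have [[y [Ay gy]]|H] := pselect (exists y, A y /\ g y = n).
    by exists y => z Az gz; apply: gi; rewrite ?gy ?gz ?in_setE.
  by exists x0 => y Ay gy; case: H; exists y.
by exists f => y Ay; exists (g y) => //; exact: fP.
Qed.

Section cdh.
Variables (X : topologicalType) (B : nat -> set X).
Hypotheses (bB : nat_base B) (cdhX : CDH X).

Lemma countable_dense_in (O : set X) : dense O ->
  exists D : set X, [/\ countable D, dense D & D `<=` O].
Proof.
move=> dO.
have /choice[d dP] : forall n, exists A : set X,
    [/\ countable A, A `<=` O & B n !=set0 -> B n `&` A !=set0].
  move=> n; have [n0|n0] := pselect (B n !=set0); last by exists set0; split.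
  have [x [Bx Ox]] := dO _ n0 (bB.1 n).
  exists [set x]; split; [exact: countable1|by move=> _ ->|by exists x].
exists (\bigcup_n d n); split.
- by apply: bigcup_countable => // n _; have [] := dP n.
- move=> U [x Ux] oU; have [n [nx nU]] := bB.2 _ _ (open_nbhs_nbhs (conj oU Ux)).
  have [_ _ []] := dP n; first by exists x.
  by move=> y [By dy]; exists y; split; [exact: nU|exists n].
- by move=> x [n _ dx]; have [_ + _] := dP n; exact.
Qed.

Lemma homeomorphism_inv (h : X -> X) : homeomorphism h ->
  exists k, [/\ homeomorphism k, cancel h k & cancel k h].
Proof.
by move=> [ch [k [hk kh ck]]]; exists k; split=> //; split; [exact: ck|exists h; split].
Qed.

(** A countable dense set through a point of S cannot be mapped onto one that
    avoids S. *)
Lemma CDH_invariant_empty (S : set X) :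
  (forall h x, homeomorphism h -> S x -> S (h x)) ->
  (exists G : set X, dense G /\ G `&` S = set0) -> S = set0.
Proof.
move=> invS [G [dG OS]]; apply/seteqP; split=> // p Sp.
have [D [cD dD DO]] := countable_dense_in dG.
have [||h [hh hD]] := cdhX.2 (D `|` [set p]) D _ _ cD dD.
- by apply: countable_setU => //; exact: countable1.
- by move=> U U0 oU; have [x [Ux Dx]] := dD U U0 oU; exists x; split=> //; left.
have : D (h p) by rewrite -hD; exists p => //; right.
move=> /DO Op; have : (G `&` S) (h p) by split=> //; exact: invS.
by rewrite OS.
Qed.

(** The boundary of the open set of points of local compactness is invariant and
    nowhere dense. *)
Lemma CDH_closed_lcompact_points : closed (@lcompact_points X).
Proof.
set L := @lcompact_points X; have oL : open L := @open_lcompact_points X.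
have invL h x : homeomorphism h -> L x -> L (h x).
  move=> [ch [k [hk kh ck]]] [K [xK cK]]; exists (k @^-1` K); split.
    by apply: ck; rewrite hk.
  have -> : k @^-1` K = h @` K.
    by apply/seteqP; split=> [y Ky|_ [y Ky <-]]; [exists (k y)|rewrite /= hk].
  by apply: continuous_compact => //; exact: continuous_subspaceT.
suff E : closure L `\` L = set0.
  move=> x clx; apply: contrapT => nLx.
  by have : (closure L `\` L) x by []; rewrite E.
apply: CDH_invariant_empty => [h x hh [clx nLx]|].
  have [k [hk hkK khK]] := homeomorphism_inv hh.
  split=> [U hxU|/(invL _ _ hk)]; last by rewrite hkK.
  have [y [Ly Uy]] := clx _ (hh.1 _ _ hxU).
  by exists (h y); split=> //; exact: invL.
exists (L `|` ~` closure L); split.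
- move=> U [x Ux] oU; have [xL|xL] := pselect (closure L x); last first.
    by exists x; split=> //; right.
  have [y [Ly Uy]] := xL U (open_nbhs_nbhs (conj oU Ux)).
  by exists y; split=> //; left.
- by apply/seteqP; split=> // x [[Lx|nx] []].
Qed.

End cdh.

(** * Baire category *)

(** If the pieces of the cover had no interior in Z, one could successively avoid
    them by nested open sets that meet Z and follow the sieve; these converge to
    a point of Z outside all pieces. *)
Lemma baire_category (T : topologicalType) (Z W : set T) O (I : countType)
    (C : I -> set T) :
  regular_space T -> complete_sieve Z O -> (forall i, closed (C i)) ->
  open W -> W `&` Z !=set0 -> W `&` Z `<=` \bigcup_i C i ->
  exists i U, [/\ open U, U `<=` W, U `&` Z !=set0 & U `&` Z `<=` C i].
Proof.
move=> rT [Ocov Ocvg] cC oW WZ WC; apply: contrapT => H.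
pose inv U := [/\ open U, U `<=` W & U `&` Z !=set0].
have /choice[st stP] : forall nU : nat * set T, exists U', inv nU.2 ->
    [/\ inv U', closure U' `<=` nU.2, closure U' `&` flat C nU.1 = set0 &
      exists N, O nU.1 N /\ U' `<=` N].
  move=> [n U] /=; have [[oU UW UZ]|] := pselect (inv U); last by exists set0.
  have cCn : closed (flat C n) by apply: flat_ind => //; exact: closed0.
  have /nonsubset[z [[Uz Zz] nCz]] : ~ U `&` Z `<=` flat C n.
    rewrite /flat; case: unpickle => [i UC|U0]; first by apply: H; exists i, U.
    by have [z /U0] := UZ.
  have [N [ON zN]] := Ocov n z Zz.
  have : nbhs z ((U `&` ~` flat C n) `&` N).
    apply: filterI zN; apply: open_nbhs_nbhs; split=> //.
    by apply: openI => //; exact: closed_openC.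
  move=> /rT[V zV VM]; exists V° => _.
  have VMM : closure V° `<=` (U `&` ~` flat C n) `&` N.
    exact: subset_trans (closureS (@interior_subset _ _)) VM.
  split; first split.
  - exact: open_interior.
  - by move=> x /subset_closure/VMM[[/UW]].
  - by exists z; split=> //; exact: nbhs_interior.
  - by move=> x /VMM[[]].
  - by apply/seteqP; split=> // x [/VMM[[_ nC] _] /nC].
  - by exists N; split=> // x /subset_closure/VMM[].
pose U := fix U n := if n is m.+1 then st (m, U m) else W.
have IU n : inv (U n).
  by elim: n => [|n IH] /=; [split|have [] := stP (n, U n) IH].
have dU n : U n.+1 `<=` U n.
  have [_ + _ _] := stP (n, U n) (IU n).
  by apply: subset_trans; exact: subset_closure.
pose F := filter_from setT (fun n => U n `&` Z).
have UF : ProperFilter F.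
  by apply: nested_filter => n; [exact: setSI|have [] := IU n].
have FU n : F (U n) by exists n => // x [].
have [||z [Zz Fz]] := Ocvg F.
- by exists 0 => // x [].
- move=> n; have [_ _ _ [N [ON UN]]] := stP (n, U n) (IU n).
  by exists N; split=> //; exact: filterS UN (FU n.+1).
have zU n : closure (U n) z.
  by move=> V /Fz FV; exact: filter_ex (filterI (FU n) FV).
have Wz : W z by have [_ + _ _] := stP (0, W) (IU 0); apply; exact: (zU 1).
have [i _ Ci] := WC z (conj Wz Zz).
have [_ _ + _] := stP (pickle i, U (pickle i)) (IU _).
rewrite flat_pickle => E.
have : (closure (U (pickle i).+1) `&` C i) z by split=> //; exact: zU.
by rewrite E.
Qed.

Lemma open_Fsigma (T : topologicalType) (B : nat -> set T) (U : set T) :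
  regular_space T -> nat_base B -> open U ->
  exists K : nat -> set T, (forall n, closed (K n)) /\ \bigcup_n K n = U.
Proof.
move=> rT bB oU; exists (fun n => keep_if (closure (B n) `<=` U) (closure (B n))).
split=> [n|].
  by apply: keep_if_ind => [|_]; [exact: closed0|exact: closed_closure].
apply/seteqP; split=> [x [n _ [BU /BU]]//|x Ux].
have /rT[V xV VU] := open_nbhs_nbhs (conj oU Ux).
have [n [nx nV]] := bB.2 _ _ xV; exists n => //; split.
  exact: subset_trans (closureS nV) VU.
exact: subset_closure.
Qed.

(** Remove from F all base sets whose trace on F is in the ideal: only a set of
    the ideal is lost, so what remains is nonempty and has no relatively open
    piece in the ideal. *)
Lemma ideal_kernel (T : topologicalType) (B : nat -> set T)
    (I : set (set T)) (F : set T) :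
  nat_base B -> closed F -> I set0 ->
  (forall A A', A `<=` A' -> I A' -> I A) ->
  (forall A : nat -> set T, (forall n, I (A n)) -> I (\bigcup_n A n)) ->
  ~ I F -> exists Z, [/\ closed Z, Z `<=` F, Z !=set0 &
    forall n, B n `&` Z !=set0 -> ~ I (B n `&` Z)].
Proof.
move=> bB cF I0 Isub IU nIF.
pose G n := keep_if (I (B n `&` F)) (B n).
have oG : open (\bigcup_n G n).
  apply: bigcup_open => n _.
  by apply: keep_if_ind => [|_]; [exact: open0|exact: bB.1].
have IGF : I (\bigcup_n G n `&` F).
  rewrite setI_bigcupl; apply: IU => n.
  by apply: (@keep_if_ind _ (fun S => I (S `&` F))) => //; rewrite set0I.
exists (F `&` ~` \bigcup_n G n); split.
- by apply: closedI => //; exact: open_closedC.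
- by move=> x [].
- apply/set0P/eqP => Z0; apply/nIF/(Isub _ _ _ IGF) => x Fx; split=> //.
  apply: contrapT => nGx.
  by have : (F `&` ~` \bigcup_n G n) x by []; rewrite Z0.
- move=> n [x [Bx [Fx nGx]]] IB; apply: nGx; exists n => //; split=> //.
  apply: (Isub _ (\bigcup_k if k is 0 then B n `&` (F `&` ~` \bigcup_n G n)
    else \bigcup_n G n `&` F)); last by apply: IU => -[|k].
  move=> y [By Fy]; have [Gy|nGy] := pselect ((\bigcup_n G n) y).
    by exists 1.
  by exists 0.
Qed.

(** * The Baire property of Borel sets *)

Definition nowhere_dense_closed (T : topologicalType) (N : set T) :=
  closed N /\ N° = set0.

Definition meager (T : topologicalType) (A : set T) :=
  exists N : nat -> set T,
    (forall n, nowhere_dense_closed (N n)) /\ A `<=` \bigcup_n N n.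

Lemma meagerS (T : topologicalType) (A A' : set T) :
  A `<=` A' -> meager A' -> meager A.
Proof. by move=> AA [N [Nn /(subset_trans AA)]]; exists N. Qed.

Lemma nowhere_dense_set0 (T : topologicalType) : nowhere_dense_closed (@set0 T).
Proof. by split; [exact: closed0|exact: interior0]. Qed.

Lemma meager_bigcup (T : topologicalType) (A : nat -> set T) :
  (forall n, meager (A n)) -> meager (\bigcup_n A n).
Proof.
move=> /choice[N NP].
exists (flat (fun p : nat * nat => N p.1 p.2)); split.
  move=> n; apply: flat_ind => [|[i j]]; first exact: nowhere_dense_set0.
  by have [+ _] := NP i; exact.
move=> x [n _ Ax]; have [_ /(_ _ Ax)[m _ Nx]] := NP n.
by exists (pickle (n, m)) => //; rewrite flat_pickle.
Qed.

Lemma nowhere_dense_meager (T : topologicalType) (N : set T) :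
  nowhere_dense_closed N -> meager N.
Proof. by move=> NN; exists (fun=> N); split=> // x Nx; exists 0. Qed.

Lemma meagerU (T : topologicalType) (A A' : set T) :
  meager A -> meager A' -> meager (A `|` A').
Proof.
move=> mA mA'; rewrite -bigcup2E; apply: meager_bigcup => -[|[|n]] //=.
exact/nowhere_dense_meager/nowhere_dense_set0.
Qed.

Definition almost_open (T : topologicalType) (A : set T) :=
  exists U, [/\ open U, meager (A `\` U) & meager (U `\` A)].

(** The complement of a set equal to the open set U up to a meager set is equal to
    the interior of the complement of U, since the boundary of U is nowhere
    dense. *)
Lemma borel_almost_open (T : topologicalType) (A : set T) :
  borel_set A -> almost_open A.
Proof.
have m0 : meager (@set0 T) by exact/nowhere_dense_meager/nowhere_dense_set0.
apply: smallest_sub; last by move=> U oU; exists U; split=> //; rewrite setDv.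
split.
- by exists set0; split; [exact: open0|rewrite setDv|rewrite setDv].
- move=> E [U [oU mAU mUA]]; exists (~` U)°; split; first exact: open_interior.
    have nU : nowhere_dense_closed (~` U `\` (~` U)°).
      split; first by apply: closedI; apply: open_closedC => //; exact: open_interior.
      apply/seteqP; split=> // x; rewrite interiorI => -[xU].
      move/interior_subset; apply; exact: xU.
    apply: meagerS (meagerU mUA (nowhere_dense_meager nU)) => x [[_ nE] nU'].
    by have [Ux|nUx] := pselect (U x); [left|right].
  apply: meagerS mAU => x [/interior_subset nU nE]; split=> //.
  by apply: contrapT => nEx; apply: nE.
- move=> E /choice[U UP]; exists (\bigcup_n U n); split.
  + by apply: bigcup_open => n _; have [] := UP n.
  + apply: (@meagerS _ _ (\bigcup_n (E n `\` U n))).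
      by move=> x [[n _ Ex] nU]; exists n => //; split=> // Ux; apply: nU; exists n.
    by apply: meager_bigcup => n; have [] := UP n.
  + apply: (@meagerS _ _ (\bigcup_n (U n `\` E n))).
      by move=> x [[n _ Ex] nU]; exists n => //; split=> // Ux; apply: nU; exists n.
    by apply: meager_bigcup => n; have [] := UP n.
Qed.

(** * Borel sets are analytic *)

Definition analytic (Y : topologicalType) (A : set Y) :=
  exists F : set (Y * baire_space), closed F /\ A = fst @` F.

Lemma reindex_continuous (Y : topologicalType) (phi : nat -> nat) :
  continuous (fun p : Y * baire_space =>
    (p.1, fun k => p.2 (phi k)) : Y * baire_space).
Proof.
move=> p U [[Q R] [/= pQ pR] QRU].
have [n nR] := agree_base pR.
exists (Q, agree (\max_(k < n) phi k).+1 (p.2 : baire_space)).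
  by split=> //=; exact: nbhs_agree nbhs_nat _ _.
move=> [y b] [/= Qy ab]; apply: QRU; split=> //=; apply: nR => k kn; apply: ab.
by rewrite ltnS; exact: (@leq_bigmax _ (fun k : 'I_n => phi k) (Ordinal kn)).
Qed.

(** The first coordinate of the witness selects the set, and the rest is a
    witness for that set. *)
Lemma analytic_bigcup (Y : topologicalType) (A : nat -> set Y) :
  (forall n, analytic (A n)) -> analytic (\bigcup_n A n).
Proof.
move=> /choice[F FP].
pose sh (p : Y * baire_space) : Y * baire_space := (p.1, fun k => p.2 k.+1).
exists [set p | F (p.2 0) (sh p)]; split.
  rewrite -openC openE => -[y a] nF.
  have shc : nbhs (y, a) (sh @^-1` ~` F (a 0)).
    apply: (@reindex_continuous Y S (y, a)); apply: open_nbhs_nbhs; split=> //.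
    by apply: closed_openC; have [] := FP (a 0).
  have a0 : nbhs (y, a) (snd @^-1` [set b : baire_space | b 0 = a 0]).
    apply: cvg_snd; apply: filterS (nbhs_agree nbhs_nat 1 a) => b; exact.
  apply: filterS (filterI shc a0) => -[z b] /= [nFb /= ->]; exact: nFb.
apply/seteqP; split=> [x [n _]|_ [[x a] /= Fa <-]].
  have [_ ->] := FP n; move=> [[y a] Fy /= <-].
  by exists (y, fun k => if k is m.+1 then a m else n).
by exists (a 0) => //; have [_ ->] := FP (a 0); exists (sh (x, a)).
Qed.

(** A single sequence codes witnesses for all the sets, along a bijection between
    pairs of naturals and naturals. *)
Lemma analytic_bigcap (Y : topologicalType) (A : nat -> set Y) :
  (forall n, analytic (A n)) -> analytic (\bigcap_n A n).
Proof.
move=> /choice[F FP].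
pose sl (n : nat) (p : Y * baire_space) : Y * baire_space :=
  (p.1, fun k => p.2 (pickle (n, k))).
exists (\bigcap_n sl n @^-1` F n); split.
  apply: closed_bigI => n _; apply: preimage_closed; last by have [] := FP n.
  by move=> p _; exact: reindex_continuous.
apply/seteqP; split=> [x Ax|_ [[x a] Fa <-] n _]; last first.
  by have [_ ->] := FP n; exists (sl n (x, a)) => //; exact: Fa.
have /choice[a aP] : forall n, exists a, F n (x, a).
  by move=> n; have := Ax n I; have [_ ->] := FP n; move=> [[y a] Fy /= <-]; exists a.
exists (x, fun k => if unpickle k is Some (n, m) then a n m else 0) => // n _.
by rewrite /sl/=; under [X in (_, X)]eq_fun do rewrite pickleK.
Qed.

Lemma closed_analytic (Y : topologicalType) (A : set Y) : closed A -> analytic A.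
Proof.
move=> cA; exists (fst @^-1` A); split.
  by apply: preimage_closed => // x _; exact: cvg_fst.
apply/seteqP; split=> [x Ax|_ [[x a] Ax <-]//].
by exists (x, fun=> 0).
Qed.

Lemma open_analytic (Y : topologicalType) (B : nat -> set Y) (A : set Y) :
  regular_space Y -> nat_base B -> open A -> analytic A.
Proof.
move=> rY bB oA; have [K [cK <-]] := open_Fsigma rY bB oA.
by apply: analytic_bigcup => n; exact: closed_analytic.
Qed.

(** The sets that are analytic together with their complement form a
    sigma-algebra. *)
Lemma borel_analytic (Y : topologicalType) (B : nat -> set Y) (A : set Y) :
  regular_space Y -> nat_base B -> borel_set A -> analytic A /\ analytic (~` A).
Proof.
move=> rY bB; apply: (@smallest_sub _ _ _ [set A | analytic A /\ analytic (~` A)]).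
  split.
  - by rewrite /= setC0; split; apply: closed_analytic; [exact: closed0|exact: closedT].
  - by move=> E [aE aE']; rewrite /= setTD setCK.
  - move=> E aE; split; first by apply: analytic_bigcup => n; have [] := aE n.
    by rewrite setC_bigcup; apply: analytic_bigcap => n; have [] := aE n.
move=> U oU; split; first exact: open_analytic rY bB oU.
by apply: closed_analytic; exact: open_closedC.
Qed.

(** * Countable bases and complete metric spaces *)

(** For each pair of sets of the countable base, pick one clopen base set between
    them when there is one. *)
Lemma nat_base_clopen (X : topologicalType) (B : nat -> set X) :
  nat_base B -> has_clopen_base X ->
  exists B' : nat -> set X, nat_base B' /\ forall n, clopen (B' n).
Proof.
move=> [oB bB] [B0 B0c [_ B0b]].
have /choice[C CP] : forall nm : nat * nat, exists C : set X, clopen C /\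
    ((exists C', [/\ B0 C', B nm.1 `<=` C' & C' `<=` B nm.2]) ->
      B nm.1 `<=` C /\ C `<=` B nm.2).
  move=> nm; have [[C [B0C nC Cm]]|H] := pselect (exists C', [/\ B0 C',
      B nm.1 `<=` C' & C' `<=` B nm.2]).
    by exists C; split=> //; exact: B0c.
  by exists set0; split=> //; exact: clopen0.
exists (flat C); split; last first.
  by apply: flat_ind => [|nm]; [exact: clopen0|have [] := CP nm].
apply: nat_base_flat => [nm|x U xU]; first by have [[]] := CP nm.
have [m [mx mU]] := bB _ _ xU.
have [C' [B0C' C'x] C'm] := B0b x (B m) (open_nbhs_nbhs (conj (oB m) mx)).
have [n [nx nC']] := bB x C' (open_nbhs_nbhs (conj (B0c _ B0C').1 C'x)).
have [_ []] := CP (n, m); first by exists C'.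
by move=> /= nC Cm; exists (n, m); split; [exact: nC|exact: subset_trans mU].
Qed.

Lemma nat_base_prod_baire (Y : topologicalType) (B : nat -> set Y) :
  nat_base B -> exists B' : nat -> set (Y * baire_space), nat_base B'.
Proof.
move=> [oB bB].
exists (flat (fun p : nat * seq nat => B p.1 `*` @cyl nat p.2)).
apply: nat_base_flat => [[n s] /=|[y a] U [[Q V] [/= yQ aV] QVU]].
  rewrite openE => -[y a] [/= ny sa]; exists (B n, @cyl nat s) => //.
  split; apply: open_nbhs_nbhs; split=> //; first exact: oB.
  exact: cyl_open nbhs_nat _.
have [n [ny nQ]] := bB _ _ yQ; have [m mV] := agree_base aV.
exists (n, mkseq a m); split=> [|[z b] [/= nz /cyl_mkseq ab]].
  by split=> //; rewrite /cyl/= size_mkseq.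
by apply: QVU; split; [exact: nQ|exact: mV].
Qed.

Section metric.
Variables (R : realType).
Local Open Scope ring_scope.

Lemma natSinv_lt (e : R) : 0 < e -> exists n : nat, n.+1%:R^-1 < e.
Proof.
move=> e0; have [N _ NP] := near_infty_natSinv_lt (PosNum e0).
by exists N; apply: NP => /=.
Qed.

Lemma metric_nat_base (X : metricType R) :
  separable X -> [set: X] !=set0 -> exists B : nat -> set X, nat_base B.
Proof.
move=> [D cD dD] [x0 _]; have [d Dd] := countable_enum x0 cD.
exists (flat (fun km : nat * nat => (ball (d km.1) km.2.+1%:R^-1)°)).
apply: nat_base_flat => [km|x U]; first exact: open_interior.
move=> /nbhs_ballP[e /= e0 eU].
have [m me] := natSinv_lt (divr_gt0 e0 (ltr0n _ 2)).
set r : R := m.+1%:R^-1 in me; have r0 : 0 < r by rewrite invr_gt0 ltr0n.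
have r20 : 0 < r / 2 by rewrite divr_gt0.
have [z [xz Dz]] : (ball x (r / 2))° `&` D !=set0.
  by apply: dD; [exists x; exact: nbhsx_ballx|exact: open_interior].
have [k _ dk] := Dd _ Dz; exists (k, m); rewrite /= dk -/r; split.
  apply: filterS (nbhsx_ballx x _ r20) => y xy.
  rewrite [r]splitr; apply: ball_triangle xy; apply: ball_sym.
  exact: interior_subset xz.
move=> y /interior_subset zy; apply: eU.
apply: le_ball (ball_triangle (interior_subset xz) zy).
rewrite (_ : e = e / 2 + e / 2); last by rewrite -splitr.
by rewrite lerD// ?(ltW me)//
  (le_trans _ (ltW me))// ler_pdivrMr// ler_peMr// ?ltW// ltr1n.
Qed.

Definition small (X : metricType R) (n : nat) (U : set X) :=
  forall x y, U x -> U y -> mdist x y < n.+1%:R^-1.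

Lemma closed_small_nbhs (X : metricType R) (x : X) (U : set X) n :
  nbhs x U -> exists K, [/\ nbhs x K, closed K, K `<=` U & small n K].
Proof.
move=> xU; have r0 : (0 : R) < n.+1%:R^-1 by rewrite invr_gt0 ltr0n.
have r20 : (0 : R) < n.+1%:R^-1 / 2 by rewrite divr_gt0.
have : nbhs x (U `&` ball x (n.+1%:R^-1 / 2)).
    exact: filterI xU (nbhsx_ballx x _ r20).
have rX : regular_space X by exact: uniform_regular.
  move=> /rX[K xK KU]; exists (closure K); split.
- exact: filterS (@subset_closure _ K) xK.
- exact: closed_closure.
- by move=> y /KU[].
- move=> y z /KU[_ xy] /KU[_ xz].
  have := ball_triangle (ball_sym xy) xz; rewrite -splitr ballEmdist.
  exact.
Qed.

Lemma small_complete (X : metricType R) (F : set_system X) :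
  complete_space X -> ProperFilter F -> (forall n, exists U, small n U /\ F U) ->
  exists x : X, F --> x.
Proof.
move=> cX pF FU; apply: cX; apply: cauchy_exP => e e0.
have [n ne] := natSinv_lt e0; have [U [nU FUn]] := FU n.
have [x Ux] := filter_ex FUn; exists x; apply: filterS FUn => y Uy.
by rewrite ballEmdist /=; apply: lt_trans ne; exact: nU.
Qed.

Lemma complete_metric_sieve (X : metricType R) :
  complete_space X -> complete_sieve [set: X] (@small X).
Proof.
move=> cX; split=> [n x _|F pF _ FU].
  by have [K [xK _ _ nK]] := closed_small_nbhs n (@filterT _ (nbhs x) _); exists K.
by have [x Fx] := small_complete cX pF FU; exists x.
Qed.

Lemma prod_baire_sieve (Y : metricType R) : complete_space Y ->
  exists O, complete_sieve [set: Y * baire_space] O.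
Proof.
move=> cY; exists (fun n => [set U | small n (fst @` U) /\
  forall p q, U p -> U q -> @agree nat n p.2 q.2]); split.
  move=> n [y a] _.
  have [K [yK _ _ nK]] := closed_small_nbhs n (@filterT _ (nbhs y) _).
  exists (K `*` @agree nat n a); split; first split.
  - by move=> _ _ [p [Kp _] <-] [q [Kq _] <-]; exact: nK.
  - by move=> p q [_ ap] [_ aq] k kn; rewrite /= ap// aq.
  - by exists (K, @agree nat n a) => //; split=> //=; exact: nbhs_agree nbhs_nat _ _.
move=> F pF _ /choice[U UP].
have [|y Fy] := @small_complete _ (fst @ F) cY _.
  move=> n; exists (fst @` U n); have [[sU _] FU] := UP n; split=> //.
  suff : F (fst @^-1` (fst @` U n)) by [].
  by apply: filterS FU => p Up; exists p.
have /choice[p pP] : forall n, exists p, U n p.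
  by move=> n; have [_ /filter_ex] := UP n.
(* Members of the cover of level k + 1 have a common k-th coordinate. *)
pose a k := (p k.+1).2 k.
have Fa n : F (snd @^-1` @agree nat n a).
  elim: n => [|n IH]; first exact: filterS filterT.
  have [[_ Ua] FUn] := UP n.+1.
  apply: filterS (filterI IH FUn) => q [/= qa Uq] k.
  rewrite ltnS leq_eqVlt => /predU1P[->|/qa//].
  exact: (Ua _ _ (pP n.+1) Uq n (ltnSn n)).
exists (y, a); split=> // W [[Q V] [/= yQ aV] QVW].
have [n nV] := agree_base aV.
have FQ : F (fst @^-1` Q) by exact: Fy.
apply: filterS (filterI FQ (Fa n)) => q [/= Qq aq]; apply: QVW; split=> //.
exact: nV.
Qed.

(** * Dense isometric embeddings *)

Section isometry.
Variables (X Y : metricType R) (i : X -> Y).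
Hypotheses (cY : complete_space Y)
  (isoi : forall x y, mdist (i x) (i y) = mdist x y) (di : dense (range i)).

Lemma isometry_nbhsP (x : X) (U : set X) :
  nbhs x U <-> exists2 V, nbhs (i x) V & i @^-1` V `<=` U.
Proof.
split=> [/nbhs_ballP[e /= e0 eU]|[V /nbhs_ballP[e /= e0 eV] VU]].
  exists (ball (i x) e); first exact: nbhsx_ballx.
  by move=> y /=; rewrite ballEmdist/= isoi => xy; apply: eU; rewrite ballEmdist.
apply/nbhs_ballP; exists e => // y; rewrite ballEmdist/= => xy.
by apply/VU/eV; rewrite ballEmdist/= isoi.
Qed.

Lemma isometry_continuous : continuous i.
Proof. by move=> x U xU; apply/isometry_nbhsP; exists U. Qed.

Lemma isometry_injective : injective i.
Proof.
by move=> x y xy; apply: (@mdist_positivity R X); rewrite -isoi xy mdistxx.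
Qed.

Lemma isometry_open (U : set X) : open U ->
  exists V : set Y, [/\ open V, U = i @^-1` V & i @` U = range i `&` V].
Proof.
move=> oU; exists (~` closure (i @` ~` U)).
have UV : U = i @^-1` (~` closure (i @` ~` U)).
  apply/seteqP; split=> x /=.
    move=> Ux; have /isometry_nbhsP[V xV VU] := open_nbhs_nbhs (conj oU Ux).
    by move=> /(_ _ xV)[_ [[y nUy <-] /VU]].
  by move=> nclx; apply: contrapT => nUx; apply: nclx; apply: subset_closure; exists x.
split=> //; first by apply: closed_openC; exact: closed_closure.
apply/seteqP; split=> [_ [x Ux <-]|_ [[x _ <-] Vx]].
  by split; [exists x|move: Ux; rewrite {1}UV].
by exists x => //; rewrite UV.
Qed.

Lemma isometry_closure (C : set X) x : closed C -> closure (i @` C) (i x) -> C x.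
Proof.
move=> cC clx; apply: cC => U /isometry_nbhsP[V xV VU].
by have [_ [[y Cy <-] Vy]] := clx _ xV; exists y; split=> //; exact: VU.
Qed.

Lemma dense_range_preimage (V : set Y) : open V -> V !=set0 -> i @^-1` V !=set0.
Proof. by move=> oV V0; have [y [Vy [x _ xE]]] := di V0 oV; exists x; rewrite /= xE. Qed.

Lemma Gdelta_sieve (O : nat -> set Y) : (forall n, open (O n)) ->
  \bigcap_n O n = range i -> exists O', complete_sieve [set: X] O'.
Proof.
move=> oO OE.
exists (fun n => [set U | exists K, [/\ closed K, K `<=` O n, small n K &
  U = i @^-1` K]]); split.
  move=> n x _; have Ox : O n (i x).
    by have : (\bigcap_n O n) (i x); [rewrite OE; exists x|exact].
  have [K [xK cK KO nK]] := closed_small_nbhs n (open_nbhs_nbhs (conj (oO n) Ox)).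
  exists (i @^-1` K); split; first by exists K.
  exact: isometry_continuous.
move=> F pF _ FU.
have [n|y Fy] := @small_complete _ (i @ F) cY _.
  by have [_ [[K [cK KO nK ->]] FK]] := FU n; exists K.
have : (\bigcap_n O n) y.
  move=> n _; have [_ [[K [cK KO nK ->]] FK]] := FU n; apply: KO; apply: cK.
  move=> V yV; have FV : F (i @^-1` V) by exact: Fy.
  by have [x [Kx Vx]] := filter_ex (filterI FK FV); exists (i x).
rewrite OE => -[x _ xy]; exists x; split=> // U /isometry_nbhsP[V].
rewrite xy => yV VU; apply: (filterS VU); exact: Fy.
Qed.

(** The n-th open set consists of the points y with a neighbourhood whose trace
    on X is pulled back by h into a small closed subset of O n. At a point y of
    their intersection, the pulled back traces form a Cauchy filter; its limit
    belongs to every O n, hence to X, and h maps it to y. *)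
Lemma Gdelta_transport (h : X -> X) (O : nat -> set Y) :
  homeomorphism h -> (forall n, open (O n)) -> \bigcap_n O n `<=` range i ->
  exists O' : nat -> set Y, (forall n, open (O' n)) /\
    \bigcap_n O' n = i @` (h @` (i @^-1` \bigcap_n O n)).
Proof.
move=> [ch [k [hk kh ck]]] oO Oi.
pose S n : set (set Y) := [set V | open V /\ exists K, [/\ closed K, K `<=` O n,
  small n K & forall x, V (i (h x)) -> K (i x)]].
exists (fun n => \bigcup_(V in S n) V); split.
  by move=> n; apply: bigcup_open => V [].
apply/seteqP; split=> [y yO|_ [_ [x Ox <-] <-] n _]; last first.
  have [K [xK cK KO nK]] := closed_small_nbhs n (open_nbhs_nbhs (conj (oO n) (Ox n I))).
  have : nbhs (h x) (k @^-1` (i @^-1` K)).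
    by apply: ck; rewrite hk; exact: isometry_continuous.
  move=> /isometry_nbhsP[V hxV VK]; exists V°.
    split; first exact: open_interior.
    by exists K; split=> // z /interior_subset/VK/=; rewrite hk.
  exact: hxV.
have /choice[V VP] : forall n, exists V, S n V /\ V y.
  by move=> n; have [V SV Vy] := yO n I; exists V.
have /choice[K KP] : forall n, exists K, [/\ closed K, K `<=` O n,
  small n K & forall x, V n (i (h x)) -> K (i x)].
  by move=> n; have [[_ [K KP]] _] := VP n; exists K.
pose F := filter_from (nbhs y) (fun W => [set x | W (i (h x))]).
have pF : ProperFilter F.
  apply: filter_from_proper; last first.
    move=> W yW; have [x Wx] : i @^-1` W° !=set0.
      by apply: dense_range_preimage; [exact: open_interior|exists y; exact: yW].
    by exists (k x); rewrite /= kh; exact: interior_subset Wx.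
  apply: filter_from_filter; first by exists setT; exact: filterT.
  by move=> W W' yW yW'; exists (W `&` W') => //; exact: filterI.
have FK n : F (i @^-1` K n).
  have [[oV _] Vy] := VP n; have [_ _ _ VK] := KP n.
  by exists (V n); [exact: open_nbhs_nbhs|move=> x /VK].
have [n|g Fg] := @small_complete _ (i @ F) cY _.
  by exists (K n); split; [have [_ _ sK _] := KP n|exact: FK].
have Og : (\bigcap_n O n) g.
  move=> n _; have [cK KO _ _] := KP n; apply: KO; apply: cK => W gW.
  have FW : F (i @^-1` W) by exact: Fg.
  by have [x [Kx Wx]] := filter_ex (filterI (FK n) FW); exists (i x).
have [x _ xg] := Oi _ Og.
exists (h x); first by exists x => //; rewrite /= xg.
apply: (@metric_hausdorff R Y) => W W' hxW yW'.
have : nbhs x (h @^-1` (i @^-1` W)) by apply: ch; exact: isometry_continuous.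
move=> /isometry_nbhsP[M]; rewrite xg => gM MW.
have FM : F (i @^-1` M) by exact: Fg.
have FW' : F [set x | W' (i (h x))] by exists W'.
have [z [Mz W'z]] := filter_ex (filterI FM FW').
by exists (i (h z)); split=> //; exact: MW.
Qed.

End isometry.
End metric.

(** * The largest meager open set of a Borel CDH space *)

Definition meager_part (X : topologicalType) : set X :=
  [set x | exists V, [/\ open V, V x & meager V]].

Lemma open_meager_part (X : topologicalType) : open (@meager_part X).
Proof.
rewrite openE => x [V [oV Vx mV]].
by apply: filterS (open_nbhs_nbhs (conj oV Vx)) => y Vy; exists V.
Qed.

Lemma meager_meager_part (X : topologicalType) (B : nat -> set X) :
  nat_base B -> meager (@meager_part X).
Proof.
move=> [oB bB].
apply: (@meagerS _ _ (\bigcup_n keep_if (meager (B n)) (B n))).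
  move=> x [V [oV Vx mV]]; have [n [nx nV]] := bB _ _ (open_nbhs_nbhs (conj oV Vx)).
  by exists n => //; split=> //; exact: meagerS mV.
apply: meager_bigcup => n; apply: keep_if_ind => //.
exact/nowhere_dense_meager/nowhere_dense_set0.
Qed.

Lemma meager_homeomorphism (X : topologicalType) (h k : X -> X) (A : set X) :
  continuous h -> continuous k -> cancel k h -> cancel h k ->
  meager A -> meager (k @^-1` A).
Proof.
move=> ch ck kh hk [N [NN AN]]; exists (fun n => k @^-1` N n); split; last first.
  by move=> x /AN[n _ Nx]; exists n.
move=> n; have [cN N0] := NN n; split.
  by apply: preimage_closed => // x _; exact: ck.
apply/seteqP; split=> // x xN; have : (N n)° (k x); last by rewrite N0.
have : nbhs (k x) (h @^-1` (k @^-1` N n)) by apply: ch; rewrite kh.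
by apply: filterS => y; rewrite /= hk.
Qed.

Lemma meager_part_homeomorphism (X : topologicalType) (h : X -> X) x :
  homeomorphism h -> meager_part x -> meager_part (h x).
Proof.
move=> [ch [k [hk kh ck]]] [V [oV Vx mV]]; exists (k @^-1` V); split.
- by apply: open_comp => // *; exact: ck.
- by rewrite /= hk.
- exact: (@meager_homeomorphism _ h).
Qed.

(** The trace of D on M is a G_delta in M, written through its complement as this
    is the form fed to the category argument. *)
Definition relatively_Gdelta (X : topologicalType) (M D : set X) :=
  exists C : nat -> set X, [/\ forall n, closed (C n),
    forall n, C n `&` D = set0 & M `\` D `<=` \bigcup_n C n].

Lemma nowhere_dense_avoid (X : topologicalType) (N : nat -> set X) (U : set X) n :
  (forall n, nowhere_dense_closed (N n)) -> open U -> U !=set0 ->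
  exists x, U x /\ forall j, j < n -> ~ N j x.
Proof.
move=> NN oU U0.
suff [V [oV [x Vx] VU VN]] : exists V, [/\ open V, V !=set0, V `<=` U &
    forall j, j < n -> V `&` N j = set0].
  exists x; split=> [|j jn Nx]; first exact: VU.
  by have : (V `&` N j) x by []; rewrite VN.
elim: n => [|n [V [oV V0 VU VN]]]; first by exists U; split.
have [cN iN] := NN n.
exists (V `&` ~` N n); split.
- by apply: openI => //; exact: closed_openC.
- apply: contrapT => VN0; have [x Vx] := V0.
  have : (N n)° x; last by rewrite iN.
  apply: filterS (open_nbhs_nbhs (conj oV Vx)) => y Vy.
  by apply: contrapT => nN; apply: VN0; exists y.
- by move=> x [/VU].
- move=> j; rewrite ltnS leq_eqVlt => /predU1P[->|/VN Vj].
    by rewrite -setIA setICl setI0.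
  by rewrite setIAC Vj set0I.
Qed.

(** Cover M by closed nowhere dense sets N m and pick the n-th point of D off
    N 0, ..., N n. Then D meets each N m in a finite set, and N m minus a finite
    set is an F_sigma. *)
Lemma meager_relatively_Gdelta (X : topologicalType) (B : nat -> set X) (M : set X) :
  regular_space X -> accessible_space X -> nat_base B -> [set: X] !=set0 ->
  meager M -> exists D, [/\ countable D, dense D & relatively_Gdelta M D].
Proof.
move=> rX aX bB X0 [N [NN MN]].
have /choice[d dP] : forall n, exists x, (forall j, j < n.+1 -> ~ N j x) /\
    (B n !=set0 -> B n x).
  move=> n; have [n0|n0] := pselect (B n !=set0).
    by have [x [Bx Nx]] := nowhere_dense_avoid n.+1 NN (bB.1 n) n0; exists x.
  by have [x [_ Nx]] := nowhere_dense_avoid n.+1 NN openT X0; exists x.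
exists (range d); split.
- exact: (@countable_sub_range _ d).
- move=> U [x Ux] oU; have [n [nx nU]] := bB.2 _ _ (open_nbhs_nbhs (conj oU Ux)).
  by exists (d n); split; [apply: nU; apply: (dP n).2; exists x|exists n].
have oF m : open (~` (d @` `I_m)).
  apply: closed_openC; move: aX => /accessible_finite_set_closed; apply.
  by apply: finite_image; exact: finite_II.
have /choice[K KP] m := open_Fsigma rX bB (oF m).
exists (flat (fun p : nat * nat => N p.1 `&` K p.1 p.2)); split.
- apply: flat_ind => [|[m k]]; first exact: closed0.
  by apply: closedI; [have [] := NN m|have [] := KP m].
- apply: (@flat_ind _ _ _ (fun S => S `&` range d = set0)) => [|[m k]].
    by rewrite set0I.
  apply/seteqP; split=> // x [[/= Nx Kx] [j _ jE]].
  have [_ KE] := KP m.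
  have : (~` (d @` `I_m)) (d j) by rewrite -KE jE; exists k.
  apply; exists j => //=; rewrite ltnNge; apply/negP => mj.
  have := (dP j).1 m; rewrite ltnS jE => /(_ mj); exact.
- move=> x [/MN[m _ Nx] nDx]; have [_ KE] := KP m.
  have : (~` (d @` `I_m)) x by move=> [j _ jx]; apply: nDx; exists j.
  by rewrite -KE => -[k _ Kx]; exists (pickle (m, k)) => //; rewrite flat_pickle.
Qed.

Lemma crowded_dense_setD1 (X : topologicalType) (D : set X) p :
  accessible_space X -> crowded X -> dense D -> dense (D `\ p).
Proof.
move=> aX crX dD U U0 oU.
have [x [Ux xp]] : exists x, U x /\ x <> p.
  have [x [y [Ux Uy xy]]] := crX U oU U0.
  have [xp|xp] := pselect (x = p); last by exists x.
  by exists y; split=> // yp; apply: xy; rewrite xp yp.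
have [||y [[Uy yp] Dy]] := dD (U `&` ~` [set p]) _ _.
- by exists x.
- by apply: openI => //; exact/closed_openC/accessible_closed_set1.
- by exists y.
Qed.

Section CDH_borel.
Variables (R : realType) (X Y : metricType R) (i : X -> Y).
Variables (BX : nat -> set X) (BY : nat -> set Y).
Hypotheses (cY : complete_space Y)
  (isoi : forall x y, mdist (i x) (i y) = mdist x y) (di : dense (range i)).
Hypotheses (bX : nat_base BX) (bY : nat_base BY) (X0 : [set: X] !=set0)
  (crX : crowded X) (cdhX : CDH X) (bori : borel_set (range i)).

Let rX : regular_space X. Proof. exact: uniform_regular. Qed.
Let rY : regular_space Y. Proof. exact: uniform_regular. Qed.
Let rP : regular_space (Y * baire_space)%type.
Proof. exact: uniform_regular. Qed.
Let aX : accessible_space X.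
Proof. exact/hausdorff_accessible/metric_hausdorff. Qed.
Let aY : accessible_space Y.
Proof. exact/hausdorff_accessible/metric_hausdorff. Qed.

Lemma meager_part_relatively_Gdelta (D : set X) :
  countable D -> dense D -> relatively_Gdelta (@meager_part X) D.
Proof.
move=> cD dD.
have [D0 [cD0 dD0 [C [cC CD MC]]]] :=
  meager_relatively_Gdelta rX aX bX X0 (meager_meager_part bX).
have [h [hh hD]] := cdhX.2 _ _ cD0 dD0 cD dD.
have [k [hk' hk kh]] := homeomorphism_inv hh.
exists (fun n => k @^-1` C n); split.
- by move=> n; apply: preimage_closed => // x _; exact: hk'.1.
- move=> n; apply/seteqP; split=> // x [Cx]; rewrite -hD => -[y Dy yx].
  have : (C n `&` D0) y by split=> //; move: Cx; rewrite /= -yx hk.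
  by rewrite CD.
- move=> x [Mx nDx]; have [|n _ Cn] := MC (k x); last by exists n.
  split; first exact: meager_part_homeomorphism.
  by move=> Dk; apply: nDx; rewrite -hD; exists (k x).
Qed.

(** Otherwise take Z closed in Y x omega^omega, projecting into M, all of whose
    nonempty open pieces have uncountable projection, and a countable dense
    set D of X containing the projection of a dense subset of Z. Then Z is
    covered by countably many fibres over points of D and by preimages of closed
    sets missing D. The former have no interior in Z by uncountability, the latter
    because they miss a dense subset of Z. *)
Lemma countable_meager_part : countable (@meager_part X).
Proof.
set M := @meager_part X.
have [V [oV MV iM]] := isometry_open isoi (@open_meager_part X).
have : analytic (i @` M).
  rewrite iM -bigcap2E; apply: analytic_bigcap => -[|[|n]] /=.
  - by have [] := borel_analytic rY bY bori.
  - exact: open_analytic rY bY oV.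
  - by apply: closed_analytic; exact: closedT.
move=> [F [cF FM]].
have [P bP] := nat_base_prod_baire bY.
have [cI|ncI] := pselect (countable (fst @` F)).
  apply: sub_countable cI; rewrite -FM.
  have iinj : {in M &, injective i} by move=> x y _ _; exact: isometry_injective.
  by have /card_eqPle[] := inj_card_eq iinj.
exfalso.
have [Z [cZ ZF [z0 Zz0] ZI]] : exists Z, [/\ closed Z, Z `<=` F, Z !=set0 &
    forall n, P n `&` Z !=set0 -> ~ countable (fst @` (P n `&` Z))].
  apply: (@ideal_kernel _ _ (fun A => countable (fst @` A))) => //.
  - by rewrite image_set0; exact: countable0.
  - move=> A A' AA; apply: sub_countable; apply: subset_card_le.
    exact: image_subset.
  - move=> A cA; rewrite image_bigcup; exact: bigcup_countable.
have [sv svP] := prod_baire_sieve cY.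
have sZ := complete_sieve_closed svP cZ.
have M0 : exists x, M x.
  have : (i @` M) z0.1 by rewrite FM; exists z0 => //; exact: ZF.
  by move=> [x Mx _]; exists x.
have /choice[e eP] : forall n, exists x, M x /\ (P n `&` Z !=set0 ->
    exists2 z, (P n `&` Z) z & i x = z.1).
  move=> n; have [[z [Pz Zz]]|nPZ] := pselect (P n `&` Z !=set0).
    have : (i @` M) z.1 by rewrite FM; exists z => //; exact: ZF.
    by move=> [x Mx xz]; exists x; split=> // _; exists z.
  by have [x Mx] := M0; exists x.
have [D0 cD0 dD0] := cdhX.1.
pose D := D0 `|` range e.
have cD : countable D.
  by apply: countable_setU => //; exact: (@countable_sub_range _ e).
have dD : dense D.
  by move=> U U0 oU; have [x [Ux Dx]] := dD0 U U0 oU; exists x; split=> //; left.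
have [C [cC CD MC]] := meager_part_relatively_Gdelta cD dD.
have [x0 _] := X0; have [d Dd] := countable_enum x0 cD.
pose G (s : nat + nat) : set (Y * baire_space) := match s with
  | inl n => fst @^-1` closure (i @` C n) | inr n => fst @^-1` [set i (d n)] end.
have cG s : closed (G s).
  by case: s => n; apply: preimage_closed => [x _|];
    [exact: cvg_fst|exact: closed_closure|exact: cvg_fst|
     exact: accessible_closed_set1].
have [|z [_ Zz]|[n|n] [U [oU _ [z [Uz Zz]] UG]]] :=
    @baire_category _ Z setT sv _ G rP sZ cG openT.
- by exists z0.
- have : (i @` M) z.1 by rewrite FM; exists z => //; exact: ZF.
  move=> [x Mx xz]; have [Dx|nDx] := pselect (D x).
    by have [n _ nx] := Dd _ Dx; exists (inr n) => //; rewrite /G/= nx xz.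
  have [n _ Cx] := MC x (conj Mx nDx); exists (inl n) => //=.
  by apply: subset_closure; exists x.
- have [m [mz mU]] := bP.2 _ _ (open_nbhs_nbhs (conj oU Uz)).
  have [_ [|z' [mz' Zz'] ez']] := eP m; first by exists z.
  have : (C n `&` D) (e m); last by rewrite CD.
  split; last by right; exists m.
  apply: (isometry_closure isoi (cC n)); rewrite ez'.
  by apply: UG; split=> //; exact: mU.
- have [m [mz mU]] := bP.2 _ _ (open_nbhs_nbhs (conj oU Uz)).
  apply: (ZI m); first by exists z.
  apply: (sub_countable _ (countable1 (i (d n)))); apply: subset_card_le.
  by move=> _ [z' [mz' Zz'] <-]; apply: UG; split=> //; exact: mU.
Qed.

(** A homeomorphism preserves M, so it cannot carry a set that contains M onto a
    set that misses a point of M. *)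
Lemma meager_part_eq0 : @meager_part X = set0.
Proof.
apply/seteqP; split=> // p Mp.
have [D0 cD0 dD0] := cdhX.1.
pose D := D0 `|` @meager_part X.
have cD : countable D.
  by apply: countable_setU => //; exact: countable_meager_part.
have dD : dense D.
  by move=> U U0 oU; have [x [Ux Dx]] := dD0 U U0 oU; exists x; split=> //; left.
have cDp : countable (D `\ p).
  by apply: sub_countable cD; apply: subset_card_le => x [].
have [h [hh hD]] := cdhX.2 _ _ cD dD cDp (crowded_dense_setD1 p aX crX dD).
have [k [hk' hk kh]] := homeomorphism_inv hh.
have : (D `\ p) p.
  by rewrite -[X in _ X]kh -hD; exists (k p) => //; right;
     exact: meager_part_homeomorphism.
by case=> _; apply.
Qed.

(** * Borel CDH spaces are completely metrizable *)

(** X agrees with an open set U of Y up to a meager set. U is dense: an open set V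
    of Y disjoint from U has a meager trace on X, hence is empty by
    [meager_part_eq0]. Removing from U an F_sigma meager set that contains
    U minus X leaves a G_delta inside X, dense by Baire category. *)
Lemma dense_Gdelta_in_range : exists O : nat -> set Y,
  [/\ forall n, open (O n), dense (\bigcap_n O n) & \bigcap_n O n `<=` range i].
Proof.
have [U [oU mSU [N [NN UN]]]] := borel_almost_open bori.
have dU : dense U.
  move=> V V0 oV; apply: contrapT => VU.
  have [x Vx] := dense_range_preimage di oV V0.
  suff : @meager_part X x by rewrite meager_part_eq0.
  exists (i @^-1` V); split=> //.
    by apply: open_comp => // y _; exact: isometry_continuous.
  have [N' [NN' SN']] := mSU.
  exists (fun n => i @^-1` N' n); split; last first.
    move=> y Vy; have [|n _ Ny] := SN' (i y); last by exists n.
    by split; [exists y|move=> Uy; apply: VU; exists (i y)].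
  move=> n; have [cN N0] := NN' n; split.
    by apply: preimage_closed => // y _; exact: isometry_continuous.
  apply/seteqP; split=> // y /(isometry_nbhsP isoi)[W yW WN].
  suff : (N' n)° (i y) by rewrite N0.
  apply: filterS (nbhs_interior yW) => z Wz; apply: cN => T zT.
  have [w [Ww Tw]] : i @^-1` (W° `&` T°) !=set0.
    apply: (dense_range_preimage di); first by apply: openI; exact: open_interior.
    by exists z; split=> //; exact: nbhs_interior.
  exists (i w); split; last exact: interior_subset Tw.
  by apply: WN; exact: interior_subset Ww.
exists (fun n => if n is m.+1 then ~` N m else U); split.
- by move=> [|n] //; apply: closed_openC; have [] := NN n.
- move=> W W0 oW; apply: contrapT => WO.
  have [|y [[Wy Uy] _]|n [V [oV _ [y [Vy _]] VN]]] :=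
      @baire_category _ setT (W `&` U) _ _ N rY (complete_metric_sieve cY)
      (fun n => (NN n).1) (openI oW oU).
  + by rewrite setIT; exact: dU.
  + apply: contrapT => nN; apply: WO; exists y; split=> // -[|n] _ //= Ny.
    by apply: nN; exists n.
  + suff : (N n)° y by rewrite (NN n).2.
    by apply: filterS (open_nbhs_nbhs (conj oV Vy)) => z Vz; apply: VN.
- move=> y yO; apply: contrapT => nSy.
  have [|n _ Ny] := UN y; first by split=> //; exact: (yO 0).
  by have := yO n.+1 I; apply.
Qed.

(** The Hurewicz-type step. If Y \ X is not covered by an F_sigma missing X, the
    kernel Z lives over Y \ X and the closures of the projections of its pieces
    meet X, at points e n. The e n lie in a G_delta subset of Y contained in X,
    whose complement is a union of closed sets covering the projection of Z; one
    of them contains the projection of a piece of Z, hence also its closure, hence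
    some e n. *)
Lemma range_Gdelta : exists O : nat -> set Y,
  (forall n, open (O n)) /\ \bigcap_n O n = range i.
Proof.
have [H [oH dH HS]] := dense_Gdelta_in_range.
have [_ [F [cF FS]]] := borel_analytic rY bY bori.
have [P bP] := nat_base_prod_baire bY.
pose I (A : set (Y * baire_space)) := exists C : nat -> set Y,
  [/\ forall n, closed (C n), forall n, C n `&` range i = set0 &
      fst @` A `<=` \bigcup_n C n].
have [[C [cC CS FC]]|nIF] := pselect (I F).
  exists (fun n => ~` C n); split; first by move=> n; exact: closed_openC.
  rewrite -setC_bigcup; apply/seteqP; split=> y.
    by move=> nCy; apply: contrapT => nSy; apply/nCy/FC; rewrite -FS.
  by move=> Sy [n _ Cy]; have : (C n `&` range i) y by []; rewrite CS.
exfalso.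
have [Z [cZ ZF [z0 Zz0] ZI]] : exists Z, [/\ closed Z, Z `<=` F, Z !=set0 &
    forall n, P n `&` Z !=set0 -> ~ I (P n `&` Z)].
  apply: (@ideal_kernel _ _ I) => //.
  - exists (fun=> set0); split=> [n|n|_ [_ []]//]; first exact: closed0.
    by rewrite set0I.
  - move=> A A' AA [C [cC CS AC]]; exists C; split=> //.
    by apply: subset_trans AC; exact: image_subset.
  - move=> A /choice[C CP]; exists (flat (fun p : nat * nat => C p.1 p.2)); split.
    + by apply: flat_ind => [|[n m]]; [exact: closed0|have [] := CP n].
    + apply: (@flat_ind _ _ _ (fun S => S `&` range i = set0)) => [|[n m]].
        by rewrite set0I.
      by have [] := CP n.
    + move=> _ [z [n _ Az] <-]; have [_ _ /(_ z.1)[|m _ Cz]] := CP n.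
        by exists z.
      by exists (pickle (n, m)) => //; rewrite flat_pickle.
have [x0 _] := X0.
have /choice[e eP] : forall n, exists x, P n `&` Z !=set0 ->
    closure (fst @` (P n `&` Z)) (i x).
  move=> n; have [PZ|] := pselect (P n `&` Z !=set0); last by exists x0.
  apply: contrapT => ncl; apply: (ZI n PZ).
  exists (fun=> closure (fst @` (P n `&` Z))); split.
  - by move=> _; exact: closed_closure.
  - move=> _; apply/seteqP; split=> // y [clx [x _ xE]].
    by apply: ncl; exists x => _; rewrite xE.
  - by move=> y PZy; exists 0 => //; exact: subset_closure.
have [D0 [cD0 dD0 D0H]] := countable_dense_in bY dH.
pose D1 := i @^-1` D0.
have cD1 : countable D1.
  by apply: countable_preimage cD0; exact: isometry_injective.
have dD1 : dense D1.
  move=> U [x Ux] oU; have [V [oV UV _]] := isometry_open isoi oU.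
  have [|y [Vy Dy]] := dD0 V _ oV; first by exists (i x); move: Ux; rewrite UV.
  have [w _ wy] := HS _ (D0H _ Dy); exists w.
  by rewrite UV /D1/= wy.
pose D2 := D1 `|` range e.
have cD2 : countable D2.
  by apply: countable_setU => //; exact: (@countable_sub_range _ e).
have dD2 : dense D2.
  by move=> U U0 oU; have [x [Ux Dx]] := dD1 U U0 oU; exists x; split=> //; left.
have [h [hh hD]] := cdhX.2 _ _ cD1 dD1 cD2 dD2.
have [H' [oH' H'E]] := Gdelta_transport cY isoi di hh oH HS.
have eH' n : (\bigcap_n H' n) (i (e n)).
  rewrite H'E; exists (e n) => //.
  have : D2 (e n) by right; exists n.
  by rewrite -hD => -[x Dx xe]; exists x => //; exact: D0H.
have [sv svP] := prod_baire_sieve cY.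
have [n||z [_ Zz]|n [U [oU _ [z [Uz Zz]] UC]]] :=
    @baire_category _ Z setT sv _
      (fun n => fst @^-1` (~` H' n) : set (Y * baire_space)) rP
      (complete_sieve_closed svP cZ) _ openT.
- apply: preimage_closed => [x _|]; [exact: cvg_fst|exact: open_closedC].
- by exists z0.
- apply: contrapT => nH; have : (~` range i) z.1.
    by rewrite FS; exists z => //; exact: ZF.
  apply; have : (\bigcap_n H' n) z.1.
    by move=> n _; apply: contrapT => nHz; apply: nH; exists n.
  by rewrite H'E => -[x _ xz]; exists x.
- have [m [mz mU]] := bP.2 _ _ (open_nbhs_nbhs (conj oU Uz)).
  have [||y [[z' [mz' Zz'] <-] H'z]] := eP m _ (H' n).
  + by exists z.
  + by apply: open_nbhs_nbhs; split=> //; exact: eH'.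
  + by have := UC z'; apply=> //; split=> //; exact: mU.
Qed.
End CDH_borel.

(** * The classification *)

Lemma isolated0_crowded (X : topologicalType) :
  isolated [set: X] = set0 -> crowded X.
Proof.
move=> iso0 U oU [x Ux]; apply: contrapT => nxy.
suff : isolated [set: X] x by rewrite iso0.
split; first by rewrite in_setT.
exists U; first exact: open_nbhs_nbhs.
rewrite setIT; apply/seteqP; split=> [y Uy|_ ->//].
by apply: contrapT => yx; apply: nxy; exists y, x.
Qed.

Lemma isometry_separable (R : realType) (X Y : metricType R) (i : X -> Y) :
  continuous i -> dense (range i) -> separable X -> separable Y.
Proof.
move=> ci di [D cD dD]; exists (i @` D).
  exact: (sub_countable (card_image_le i D)).
move=> V V0 oV; have [y0 [Vy0 [x _ xE]]] := di V V0 oV.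
have [||y [Vy Dy]] := dD (i @^-1` V).
- by exists x; rewrite /= xE.
- by apply: open_comp => // z _; exact: ci.
- by exists (i y); split=> //; exists y.
Qed.

Lemma borel_CDH_complete_sieve (R : realType) (X : metricType R) :
  [set: X] !=set0 -> separable X -> crowded X -> borel_space X -> CDH X ->
  exists O, complete_sieve [set: X] O.
Proof.
move=> X0 sX crX [Y [i [[cY isoi di] bori]]] cdhX.
have [BX bX] := metric_nat_base sX X0.
have sY := isometry_separable (isometry_continuous isoi) di sX.
have Y0 : [set: Y] !=set0 by have [x _] := X0; exists (i x).
have [BY bY] := metric_nat_base sY Y0.
have [G [oG GE]] := range_Gdelta cY isoi di bX bY X0 crX cdhX bori.
exact: (Gdelta_sieve cY isoi oG GE).
Qed.

Theorem corollary2p5 (R : realType) (X : metricType R) :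
  [set: X] !=set0 ->
  has_clopen_base X ->
  separable X ->
  isolated [set: X] = set0 ->
  borel_space X ->
  CDH X ->
  homeomorphic X cantor_space \/
  homeomorphic X baire_space \/
  homeomorphic X punctured_cantor_space \/
  homeomorphic X (topological_sum baire_space cantor_space) \/
  homeomorphic X (topological_sum baire_space punctured_cantor_space).
Proof.
move=> X0 zX sX /isolated0_crowded crX bX cdhX.
have [sv svP] := borel_CDH_complete_sieve X0 sX crX bX cdhX.
have [B0 bB0] := metric_nat_base sX X0.
have [B [bB cB]] := nat_base_clopen bB0 zX.
apply: (crowded_classification _ bB cB crX X0 svP).
  exact: metric_hausdorff.
exact: CDH_closed_lcompact_points bB cdhX.
Qed.
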